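(* Let $A,B\in GL(d,\mathbb{R})$, let $\phi\in C_c^\infty(\mathbb{R}^d)$ be nonnegative with $\operatorname{supp}\phi\subseteq\{x\in\mathbb{R}^d:\|x\|_2\le 1\}$ and $\int\phi=1$, and for $\epsilon>0$ put $\phi_\epsilon(x)=\epsilon^{-d}\phi(x/\epsilon)$. (1) If $\Omega\subseteq\mathbb{R}^d$ is measurable and $\epsilon>0$ are such that $\Omega$ is a fundamental domain for $A\mathbb{Z}^d$ and $\Omega_\epsilon$ is a packing set for $B^{-T}\mathbb{Z}^d$, then $\big(\sqrt{\chi_\Omega*\phi_\epsilon},\,A\mathbb{Z}^d\times B\mathbb{Z}^d\big)$ is a tight frame for $L^2(\mathbb{R}^d)$ with frame bound $1/|\det B|$. (2) If $\Omega\subseteq\mathbb{R}^d$ is measurable and $\epsilon>0$ are such that $\Omega$ is a fundamental domain for $B^{-T}\mathbb{Z}^d$ and $\Omega_\epsilon$ is a packing set for $A\mathbb{Z}^d$, then $\big(\sqrt{\chi_\Omega*\phi_\epsilon},\,A\mathbb{Z}^d\times B\mathbb{Z}^d\big)$ is an orthogonal system in $L^2(\mathbb{R}^d)$.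
   Context: $\chi_\Omega$ is the characteristic function of $\Omega$; $\Omega_\epsilon=\{x+y: x\in\Omega,\ \|y\|_2\le\epsilon\}$; $B^{-T}=(B^T)^{-1}$; $*$ is convolution. For a full rank lattice $\Gamma\subset\mathbb{R}^d$, a set $\Omega$ is a packing set for $\Gamma$ if $(\Omega+\gamma_1)\cap(\Omega+\gamma_2)$ is a null set for all distinct $\gamma_1,\gamma_2\in\Gamma$; it is a fundamental domain (tiling set) for $\Gamma$ if in addition its translates by $\Gamma$ cover $\mathbb{R}^d$ (equivalently $\sum_{\gamma\in\Gamma}\chi_\Omega(x-\gamma)=1$ for almost every $x$). For $\lambda=(x,\omega)\in\mathbb{R}^{2d}$ let $(\pi(\lambda)g)(t)=e^{2\pi i\langle\omega,t\rangle}g(t-x)$. For $g\in L^2(\mathbb{R}^d)$ and a full rank lattice $\Lambda\subset\mathbb{R}^{2d}$, the Gabor system $(g,\Lambda)$ is the family $\{\pi(\lambda)g\}_{\lambda\in\Lambda}$. It is a frame for $L^2(\mathbb{R}^d)$ with bounds $0<a\le b$ if $a\|f\|^2\le\sum_{\lambda\in\Lambda}|\langle f,\pi(\lambda)g\rangle|^2\le b\|f\|^2$ for all $f\in L^2(\mathbb{R}^d)$; it is a tight frame with frame bound $a$ if this holds with $a=b$. *)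

(* Defs.v *)
From HB Require Import structures.
From mathcomp Require Import all_boot all_order all_algebra.
From mathcomp Require Import all_classical all_reals all_analysis.
From mathcomp Require Import complex.

Set Implicit Arguments.
Unset Strict Implicit.
Unset Printing Implicit Defensive.

Import Order.TTheory GRing.Theory Num.Theory.
Import numFieldNormedType.Exports.

Local Open Scope classical_set_scope.
Local Open Scope ring_scope.

(* As for tuples in the library, column vectors carry the sigma-algebra       *)
(* generated by the coordinates; on 'cV[R]_n this is the Borel sigma-algebra. *)
Definition cV_display : measure_display -> measure_display.
Proof. exact. Qed.

Section measurable_cV.
Context {d : measure_display} {T : measurableType d} (n : nat).

Definition cV_coord (i : 'I_n) (x : 'cV[T]_n) : T := x i ord0.

Let cV_set0 : g_sigma_preimage cV_coord set0.
Proof. exact: sigma_algebra0. Qed.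

Let cV_setC A : g_sigma_preimage cV_coord A -> g_sigma_preimage cV_coord (~` A).
Proof. exact: sigma_algebraC. Qed.

Let cV_bigcup (F : (set 'cV[T]_n)^nat) :
  (forall i, g_sigma_preimage cV_coord (F i)) ->
  g_sigma_preimage cV_coord (\bigcup_i (F i)).
Proof. exact: sigma_algebra_bigcup. Qed.

HB.instance Definition _ := @isMeasurable.Build (cV_display d)
  'cV[T]_n (g_sigma_preimage cV_coord) cV_set0 cV_setC cV_bigcup.

End measurable_cV.

Lemma measurable_cV_coord d (T : measurableType d) n (i : 'I_n) :
  measurable_fun [set: 'cV[T]_n] (cV_coord i).
Proof.
move=> _ Y mY; rewrite setTI; apply: sub_sigma_algebra => /=.
rewrite -bigcup_seq/=; exists i => /=; first by rewrite mem_index_enum.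
by exists Y => //; rewrite setTI.
Qed.

Lemma measurable_fun_cVP d1 d2 (T1 : measurableType d1) (T2 : measurableType d2)
    n (f : T1 -> 'cV[T2]_n) :
  measurable_fun [set: T1] f <->
  forall i, measurable_fun [set: T1] (fun x => f x i ord0).
Proof.
split=> [mf i|mf].
  exact: (measurableT_comp (measurable_cV_coord i) mf).
have sub : g_sigma_preimage (fun i => @cV_coord _ T2 n i \o f) `<=` measurable.
  apply: smallest_sub; first exact: sigma_algebra_measurable.
  rewrite -bigcup_seq/=; apply: bigcup_sub => i _.
  by move=> A [B mB <-]; exact: mf.
move: sub; rewrite g_sigma_preimage_comp => prefS _ A mA.
by apply: prefS; exists A.
Qed.

Section lebesgue_measure_cV.
Variable R : realType.

Definition consV n (p : measurableTypeR R * 'cV[R]_n) : 'cV[R]_n.+1 :=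
  col_mx (const_mx p.1 : 'cV_1) p.2.

Definition unconsV n (x : 'cV[R]_n.+1) : measurableTypeR R * 'cV[R]_n :=
  (x ord0 ord0, \col_i x (lift ord0 i) ord0).

Lemma consV0 n (p : measurableTypeR R * 'cV[R]_n) :
  consV p ord0 ord0 = p.1.
Proof. by rewrite /consV mxE; case: splitP => // j _; rewrite mxE. Qed.

Lemma consVS n (p : measurableTypeR R * 'cV[R]_n) i :
  consV p (lift ord0 i) ord0 = p.2 i ord0.
Proof.
rewrite /consV mxE; case: splitP => [[[]]//|k]; rewrite lift0 add1n => -[ik].
by congr (p.2 _ _); exact/val_inj.
Qed.

Lemma consVK n : cancel (@consV n) (@unconsV n).
Proof.
case=> a x; rewrite /unconsV consV0; congr pair.
by apply/colP => i; rewrite mxE consVS.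
Qed.

Lemma measurable_consV n : measurable_fun setT (@consV n).
Proof.
apply/measurable_fun_cVP => i; case: (unliftP ord0 i) => [j ->|->]; last first.
  by under eq_fun do rewrite consV0; exact: measurable_fst.
under eq_fun do rewrite consVS.
exact: (measurableT_comp (measurable_cV_coord j) measurable_snd).
Qed.

Lemma measurable_unconsV n : measurable_fun setT (@unconsV n).
Proof.
apply: measurable_fun_pair; first exact: (measurable_cV_coord ord0).
apply/measurable_fun_cVP => i.
by under eq_fun do rewrite mxE; exact: (measurable_cV_coord (lift ord0 i)).
Qed.

Section lebesgue_cons.
Variables (n : nat) (mu : {sigma_finite_measure set 'cV[R]_n -> \bar R}).

Definition lebesgue_cons : set 'cV[R]_n.+1 -> \bar R :=
  pushforward (lebesgue_measure \x mu)%E (@consV n).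

Let cons0 : lebesgue_cons set0 = 0%E.
Proof. by rewrite /lebesgue_cons /pushforward preimage_set0 measure0. Qed.

Let cons_ge0 A : (0 <= lebesgue_cons A)%E.
Proof. by rewrite /lebesgue_cons /pushforward measure_ge0. Qed.

Let cons_sigma_additive : semi_sigma_additive lebesgue_cons.
Proof.
apply: (@measure_semi_sigma_additive _ _ _
  (measure_function_pushforward__canonical__measure_function_Measure
    (lebesgue_measure \x mu)%E (@measurable_consV n))).
Qed.

HB.instance Definition _ := isMeasure.Build _ _ _ lebesgue_cons
  cons0 cons_ge0 cons_sigma_additive.

Let lebesgue_cons_sigma_finite : sigma_finite setT lebesgue_cons.
Proof.
have /sigma_finiteP[F [TF ndF mF]] :=
  sigma_finiteT (lebesgue_measure : set (measurableTypeR R) -> \bar R).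
have /sigma_finiteP[G [TG ndG mG]] := sigma_finiteT mu.
have mFG k : measurable (F k `*` G k).
  by have [? _] := mF k; have [? _] := mG k; exact: measurableX.
exists (fun k => @unconsV n @^-1` (F k `*` G k)).
  rewrite -preimage_bigcup; apply/esym; rewrite -subTset => x _ /=.
  have [k _ Fk] : (\bigcup_k F k) (unconsV x).1 by rewrite -TF.
  have [l _ Gl] : (\bigcup_k G k) (unconsV x).2 by rewrite -TG.
  exists (maxn k l) => //; split.
    by move: Fk; exact/subsetPset/ndF/leq_maxl.
  by move: Gl; exact/subsetPset/ndG/leq_maxr.
move=> k; split.
  by rewrite -[X in measurable X]setTI; exact: measurable_unconsV.
rewrite /lebesgue_cons /pushforward -comp_preimage.
rewrite (_ : _ \o _ = id); last by apply/funext => p; exact: consVK.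
have [mFk Fk] := mF k; have [mGk Gk] := mG k.
by rewrite preimage_id product_measure1E// lte_mul_pinfty// ge0_fin_numE.
Qed.

HB.instance Definition _ := Measure_isSigmaFinite.Build _ _ _ lebesgue_cons
  lebesgue_cons_sigma_finite.

End lebesgue_cons.

(* Lebesgue measure on R^n as the n-fold product of the one on R. *)
Fixpoint lebesgue_cV (n : nat) : {sigma_finite_measure set 'cV[R]_n -> \bar R} :=
  if n is m.+1 then lebesgue_cons (lebesgue_cV m) else \d_(0 : 'cV[R]_0).

Lemma lebesgue_cV_box n (A : 'I_n -> set R) :
  (forall i, measurable (A i)) ->
  lebesgue_cV n [set x | forall i, A i (x i ord0)] =
  (\prod_(i < n) (lebesgue_measure (A i : set (measurableTypeR R))))%E.
Proof.
elim: n A => [|n IH] A mA.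
  rewrite big_ord0 /= diracE mem_set//=; by case.
rewrite big_ord_recl -IH//= /lebesgue_cons /pushforward.
pose B := [set x : 'cV[R]_n | forall i, A (lift ord0 i) (x i ord0)].
rewrite -[X in (_ * lebesgue_cV _ X)%E]/B.
have mB : measurable B.
  rewrite (_ : B = \big[setI/setT]_(i < n) (cV_coord i @^-1` A (lift ord0 i))).
    apply: bigsetI_measurable => i _; rewrite -[X in measurable X]setTI.
    exact: measurable_cV_coord.
  rewrite -bigcap_seq; apply/seteqP; split=> x /= h i.
    by move=> _; exact: h.
  exact: (h i (mem_index_enum i)).
transitivity ((lebesgue_measure \x lebesgue_cV n)%E
    ((A ord0 : set (measurableTypeR R)) `*` B)); last first.
  by apply: product_measure1E => //; exact: mA.
congr (_ _); apply/seteqP; split=> p /=.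
  move=> h; split; first by rewrite -(consV0 p); exact: h.
  by move=> i; rewrite -(consVS p); exact: h.
move=> [h0 hS] i; case: (unliftP ord0 i) => [j ->|->]; last by rewrite consV0.
by rewrite consVS; exact: hS.
Qed.

End lebesgue_measure_cV.

Section euclidean.
Context {R : realType} {d : nat}.
Local Notation V := 'cV[R]_d.
Local Notation mu := (lebesgue_cV R d).

(* Measurability with respect to the completion of the Borel sigma-algebra    *)
(* ('measurable' alone is Borel measurability).                               *)
Definition lebesgue_measurable (A : set V) : Prop :=
  exists2 B : set V, measurable B & mu.-negligible ((A `\` B) `|` (B `\` A)).

Definition dotv (x y : V) : R := \sum_(i < d) x i ord0 * y i ord0.

(* The norm `|x| of 'cV[R]_d in the library is the sup norm. *)
Definition enorm (x : V) : R := Num.sqrt (dotv x x).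

Definition fattening (A : set V) (eps : R) : set V :=
  [set x + y | x in A & y in [set y | enorm y <= eps]].

Definition lattice (M : 'M[R]_d) : set V :=
  [set M *m map_mx intr k | k in [set: 'cV[int]_d]].

Definition translate (A : set V) (v : V) : set V := [set x + v | x in A].

Definition packing_set (G : set V) (A : set V) : Prop :=
  forall u v, G u -> G v -> u != v ->
    mu.-negligible (translate A u `&` translate A v).

(* The covering condition is required up to a null set. *)
Definition fundamental_domain (G : set V) (A : set V) : Prop :=
  packing_set G A /\ mu.-negligible (~` \bigcup_(u in G) translate A u).

Fixpoint partials (s : seq 'I_d) (f : V -> R) : V -> R :=
  if s is i :: s' then fun x => 'D_(delta_mx i ord0) (partials s' f) x else f.

Definition smooth (f : V -> R) : Prop :=
  forall s, continuous (partials s f) /\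
    forall i x, derivable (partials s f) x (delta_mx i ord0).

Definition supp (f : V -> R) : set V := closure [set x | f x != 0].

Definition Cc_infty (f : V -> R) : Prop := smooth f /\ compact (supp f).

Definition convolution (f h : V -> R) : V -> R :=
  fun x => \int[mu]_y (f y * h (x - y)).

Definition dilate (eps : R) (f : V -> R) : V -> R :=
  fun x => (eps ^+ d)^-1 * f (eps^-1 *: x).

End euclidean.

Section gabor.
Context {R : realType} {d : nat}.
Local Notation V := 'cV[R]_d.
Local Notation mu := (lebesgue_cV R d).

(* L^2(R^d) is handled through Borel representatives: every class has one,    *)
(* and norms and inner products depend only on the classes.                   *)
Definition L2norm (f : V -> R[i]) : \bar R :=
  ('N[mu]_2%:E [ (fun t => (ComplexField.Normc.normc (f t))%:E) ])%E.

Definition L2 (f : V -> R[i]) : Prop :=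
  [/\ measurable_fun [set: V] (fun t => complex.Re (f t)),
      measurable_fun [set: V] (fun t => complex.Im (f t)) &
      (L2norm f < +oo)%E].

Definition inner (f h : V -> R[i]) : R[i] :=
  Complex (\int[mu]_t complex.Re (f t * conjc (h t)))
          (\int[mu]_t complex.Im (f t * conjc (h t))).

Definition is_frame (I : choiceType) (J : set I) (e : I -> V -> R[i])
    (a b : R) : Prop :=
  [/\ 0 < a, a <= b, forall j, J j -> L2 (e j) &
    forall f, L2 f ->
      (a%:E * L2norm f ^+ 2 <=
       (\esum_(j in J) (ComplexField.Normc.normc (inner f (e j)) ^+ 2)%:E)%R <=
       b%:E * L2norm f ^+ 2)%E].

Definition is_tight_frame (I : choiceType) (J : set I) (e : I -> V -> R[i])
    (a : R) : Prop := is_frame J e a a.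

Definition is_orthogonal_system (I : choiceType) (J : set I)
    (e : I -> V -> R[i]) : Prop :=
  (forall j, J j -> L2 (e j)) /\
  (forall j k, J j -> J k -> j != k -> inner (e j) (e k) = 0).

Definition expi (x : R) : R[i] := Complex (cos x) (sin x).

(* (tfshift g l)(t) = e^{2 pi i <l.2, t>} g(t - l.1) *)
Definition tfshift (g : V -> R[i]) (l : V * V) : V -> R[i] :=
  fun t => expi (2 * pi * dotv l.2 t) * g (t - l.1).

Definition window (A : set V) (phi : V -> R) (eps : R) : V -> R[i] :=
  fun t => Complex (Num.sqrt (convolution (\1_A) (dilate eps phi) t)) 0.

End gabor.

(* Main.v *)
Require Import Defs.
From HB Require Import structures.
From mathcomp Require Import all_boot all_order all_algebra.
From mathcomp Require Import all_classical all_reals all_analysis.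
From mathcomp Require Import measurable_realfun complex.
From mathcomp Require Import ring lra.

Set Implicit Arguments.
Unset Strict Implicit.
Unset Printing Implicit Defensive.

Import Order.TTheory GRing.Theory Num.Theory.
Import numFieldNormedType.Exports.

Local Open Scope classical_set_scope.
Local Open Scope ring_scope.

(* Call a nonnegative function w a weight for a lattice if its lattice         *)
(* translates sum to 1 almost everywhere. If Omega is a fundamental domain,    *)
(* then w = chi_Omega * phi_eps is a weight for the same lattice, vanishing    *)
(* outside Omega_eps. Exchanging sum and integral shows that the integral of a *)
(* periodic function against a weight does not depend on the weight; it is     *)
(* the covolume for the constant 1, and 0 for a nontrivial character, since    *)
(* translating by a half period changes the sign.                              *)
(* (2) The translates of sqrt w by distinct points of AZ^d have disjoint       *)
(* supports, and <pi(x,o) g, pi(x,o') g> is the integral of a nontrivial       *)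
(* character against a translate of w.                                         *)
(* (1) f . T_x g lives on a packing set of B^{-T}Z^d, so Parseval's identity   *)
(* for the characters indexed by BZ^d gives |det B|^{-1} int |f|^2 w(. - x) as *)
(* the sum over the frequencies, and summing over x leaves int |f|^2.          *)
(* Parseval's identity needs the density of trigonometric polynomials in L^2   *)
(* of a fundamental domain F. The bounded functions u such that u f is         *)
(* approximable whenever f is contain the real trigonometric polynomials and   *)
(* are closed under products and bounded pointwise limits, so the sets whose   *)
(* indicator is of this kind form a sigma-algebra; it contains every periodic  *)
(* Borel set, and every Borel subset of F is the trace of a periodic one.      *)

(** * Lebesgue measure under affine maps *)

(** Tiling enters as a partition of unity and packing as disjointness of supports. By
    [weight_convolution] the smoothed indicator still has lattice translates summing to 1, because
    convolving with a function of integral 1 commutes with translations. By [window_exact_support]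
    the window agrees almost everywhere with the root of a weight [w] carried by a set [P] whose
    translates by the second lattice are genuinely disjoint.

    [tight_frame_identity] uses the partition of unity over the translations [lattice A] and the
    disjointness over the dual of the frequency lattice. [orthogonality_identity] uses the same two
    facts with the lattices exchanged.

    The Fourier input to the first is [lattice_parseval]. It rests on Bessel's inequality and its
    converse for a well approximated function ([bessel], [bessel_lower]), and on density of
    trigonometric polynomials, which [multiplier_fracv] and [approximable_square_integrable]
    provide. The Fourier input to the second is that nontrivial characters integrate to 0 against
    any weight ([Rintegral_antiperiodic]). Both need Lebesgue measure on column vectors to be
    translation invariant and to scale by the determinant ([ge0_integral_shift],
    [ge0_integral_mulmx]). *)

Section lebesgue_R.
Variable R : realType.
Local Notation lam := (@lebesgue_measure R).

Lemma measurable_affine (a b : R) : measurable_fun [set: R] (fun x => a * x + b).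
Proof. by apply: measurable_funD => //; exact: mulrl_measurable. Qed.

Lemma preimage_affine_itv (a b u v : R) : 0 < a ->
  (fun x => a * x + b) @^-1` `]u, v]%classic = `](u - b) / a, (v - b) / a]%classic.
Proof.
move=> a0; apply/seteqP; split => x /=; rewrite !in_itv/=;
  by rewrite ltr_pdivrMr// ler_pdivlMr// ltrBlDr lerBrDr mulrC.
Qed.

Lemma preimage_affine_itvN (a b u v : R) : a < 0 ->
  (fun x => a * x + b) @^-1` `]u, v]%classic = `[(v - b) / a, (u - b) / a[%classic.
Proof.
move=> a0; apply/seteqP; split => x /=; rewrite !in_itv/=;
  by rewrite ltr_ndivlMr// ler_ndivrMr// ltrBlDr lerBrDr mulrC andbC.
Qed.

(** By uniqueness of Lebesgue measure it is enough to compare lengths on the half-open intervals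
    []u, v]]. For negative [a] the preimage is closed on the other side, which does not change its
    length. *)
Lemma lebesgue_measure_affine (a b : R) (A : set R) : a != 0 -> measurable A ->
  (`|a|%:E * lam ((fun x => a * x + b)%R @^-1` A) = lam A)%E.
Proof.
move=> a0 mA; have an0 : 0 <= `|a| by [].
pose k : {nonneg R} := NngNum an0.
have mf : measurable_fun [set: measurableTypeR R]
  ((fun x : R => (a * x + b : measurableTypeR R)) : measurableTypeR R -> _).
  exact: measurable_affine.
pose nu := mscale k
  (measure_function_pushforward__canonical__measure_function_Measure lam mf).
have -> // : lam A = nu A.
apply: (@lebesgue_measure_unique R (mscale k
  (measure_function_pushforward__canonical__measure_function_Measure lam mf))) => //.
move=> _ [[u v]] _ <-.
change (lam `]u, v] = `|a|%:E * lam ((fun x => a * x + b)%R @^-1` `]u, v]%classic))%E.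
have [ap|an|] := ltgtP a 0; last by move=> a00; rewrite a00 eqxx in a0.
  rewrite preimage_affine_itvN// !lebesgue_measure_itv/= !lte_fin.
  rewrite ltr_ndivrMr// divfK// ltrD2r; case: ifPn => uv; last by rewrite mule0.
  rewrite -!EFinD -EFinM ltr0_norm//; congr EFin; field; exact: a0.
rewrite preimage_affine_itv// !lebesgue_measure_itv/= !lte_fin.
rewrite ltr_pdivrMr// divfK// ltrD2r; case: ifPn => uv; last by rewrite mule0.
rewrite -!EFinD -EFinM gtr0_norm//; congr EFin; field; exact: a0.
Qed.

Lemma ge0_integral_affine (a b : R) (f : R -> \bar R) : a != 0 ->
  measurable_fun [set: R] f -> (forall x, 0 <= f x)%E ->
  (`|a|%:E * \int[lam]_x f (a * x + b)%R = \int[lam]_x f x)%E.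
Proof.
move=> a0 mf f0; have an0 : 0 <= `|a| by [].
pose k : {nonneg R} := NngNum an0.
have mh : measurable_fun [set: measurableTypeR R]
  ((fun x : R => (a * x + b : measurableTypeR R)) : measurableTypeR R -> _).
  exact: measurable_affine.
pose nu := mscale k
  (measure_function_pushforward__canonical__measure_function_Measure lam mh).
transitivity (\int[nu]_x f x)%E.
  rewrite ge0_integral_mscale//; congr (_ * _)%E.
  by rewrite ge0_integral_pushforward.
by apply: eq_measure_integral => A mA _; exact: lebesgue_measure_affine.
Qed.

End lebesgue_R.

Section lebesgue_cV_linear.
Variable R : realType.
Local Notation lam := (@lebesgue_measure R).
Local Notation mu n := (lebesgue_cV R n).

Lemma measurable_fun_mulmxD m n (M : 'M[R]_(m, n)) (v : 'cV[R]_m) :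
  measurable_fun [set: 'cV[R]_n] (fun x => M *m x + v).
Proof.
apply/measurable_fun_cVP => i.
under eq_fun do rewrite !mxE.
apply: measurable_funD => //; apply: measurable_sum => j.
by apply: measurable_funM => //; exact: (measurable_cV_coord j).
Qed.

Lemma measurable_fun_mulmx m n (M : 'M[R]_(m, n)) :
  measurable_fun [set: 'cV[R]_n] (mulmx M).
Proof.
apply: eq_measurable_fun (measurable_fun_mulmxD M 0) => x _.
by rewrite addr0.
Qed.

Lemma measurable_fun_shift n (v : 'cV[R]_n) :
  measurable_fun [set: 'cV[R]_n] (fun x => x + v).
Proof.
apply: eq_measurable_fun (measurable_fun_mulmxD 1%:M v) => x _.
by rewrite mul1mx.
Qed.

Lemma measurable_fun_cons n (f : 'cV[R]_n.+1 -> \bar R) :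
  measurable_fun setT f ->
  measurable_fun setT (fun p : measurableTypeR R * 'cV[R]_n => f (consV p)).
Proof. by move=> mf; exact: (measurableT_comp mf (@measurable_consV R n)). Qed.

Lemma integral_cVS n (f : 'cV[R]_n.+1 -> \bar R) :
  measurable_fun setT f -> (forall x, 0 <= f x)%E ->
  (\int[mu n.+1]_x f x = \int[mu n]_y \int[lam]_a f (consV (a, y)))%E.
Proof.
move=> mf f0.
have -> : (\int[mu n.+1]_x f x =
           \int[(lam \x mu n)%E]_p f (consV p))%E.
  by rewrite [LHS](ge0_integral_pushforward (@measurable_consV R n)).
by rewrite (fubini_tonelli2 (fun p => f (consV p)))//; exact: measurable_fun_cons.
Qed.

(** The other order of Tonelli. With the tail integrated inside, a shear that moves the tail by a
    multiple of the first coordinate is an inner translation; [integral_cVS] plays this part for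
    shears moving the first coordinate. *)
Lemma integral_cVS_slices n (f : 'cV[R]_n.+1 -> \bar R) :
  measurable_fun setT f -> (forall x, 0 <= f x)%E ->
  (\int[mu n.+1]_x f x = \int[lam]_a \int[mu n]_y f (consV (a, y)))%E.
Proof.
move=> mf f0.
have -> : (\int[mu n.+1]_x f x =
           \int[(lam \x mu n)%E]_p f (consV p))%E.
  by rewrite [LHS](ge0_integral_pushforward (@measurable_consV R n)).
by rewrite (fubini_tonelli1 (fun p => f (consV p)))//; exact: measurable_fun_cons.
Qed.

Lemma measurable_consV1 n (f : 'cV[R]_n.+1 -> \bar R) (y : 'cV[R]_n) :
  measurable_fun setT f -> measurable_fun [set: R] (fun a => f (consV (a, y))).
Proof.
move=> /measurable_fun_cons mf.
have mp : measurable_fun [set: measurableTypeR R] (fun a : measurableTypeR R => (a, y)).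
  by apply: measurable_fun_pair.
exact: (measurableT_comp mf mp).
Qed.

Lemma measurable_consV2 n (f : 'cV[R]_n.+1 -> \bar R) (a : R) :
  measurable_fun setT f -> measurable_fun setT (fun y => f (consV (a, y))).
Proof.
move=> /measurable_fun_cons mf.
have mp : measurable_fun setT (fun y : 'cV[R]_n => (a : measurableTypeR R, y)).
  by apply: measurable_fun_pair.
exact: (measurableT_comp mf mp).
Qed.

Lemma consVD n (a b : R) (x y : 'cV[R]_n) :
  consV (a, x) + consV (b, y) = consV (a + b, x + y).
Proof.
apply/colP => i; rewrite mxE; case: (unliftP ord0 i) => [j ->|->].
  by rewrite !consVS mxE.
by rewrite !consV0.
Qed.

Lemma consV_uncons n (v : 'cV[R]_n.+1) : consV (unconsV v) = v.
Proof.
apply/colP => i; case: (unliftP ord0 i) => [j ->|->]; last by rewrite consV0.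
by rewrite consVS mxE.
Qed.

Lemma ge0_integral_shift n (f : 'cV[R]_n -> \bar R) (v : 'cV[R]_n) :
  measurable_fun setT f -> (forall x, 0 <= f x)%E ->
  (\int[mu n]_x f (x + v)%R = \int[mu n]_x f x)%E.
Proof.
elim: n f v => [|n IH] f v mf f0.
  by apply: eq_integral => x _; congr f; apply/colP => -[].
have mfv : measurable_fun setT (fun x : 'cV[R]_n.+1 => f (x + v)).
  exact: (measurableT_comp mf (measurable_fun_shift v)).
rewrite -(consV_uncons v) in mfv *; case: (unconsV v) mfv => b w mfv.
pose g y := (\int[lam]_a f (consV (a, y)))%E.
have mg : measurable_fun setT g.
  apply: (measurable_fun_fubini_tonelli_G (fun p => f (consV p))) => //.
  exact: measurable_fun_cons.
have g0 y : (0 <= g y)%E by exact: integral_ge0.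
rewrite (integral_cVS mfv (fun=> f0 _)) (integral_cVS mf f0).
rewrite -/g -(IH g w mg g0).
apply: eq_integral => y _; rewrite /g.
rewrite -(ge0_integral_affine b (oner_neq0 R) (measurable_consV1 (y + w) mf))//.
rewrite normr1 mul1e; apply: eq_integral => a _.
by rewrite consVD mul1r.
Qed.

End lebesgue_cV_linear.

(** * Linear change of variables by Gaussian elimination *)

Section lebesgue_cV_mulmx.
Variable R : realType.
Local Notation lam := (@lebesgue_measure R).
Local Notation mu n := (lebesgue_cV R n).

(** The change of variables formula as a property of the matrix alone: quantifying over all [f]
    makes it stable under products, so that it can be checked on elementary factors. *)
Let scales n (M : 'M[R]_n) := forall f : 'cV[R]_n -> \bar R,
  measurable_fun setT f -> (forall x, 0 <= f x)%E ->
  (`|\det M|%:E * \int[mu n]_x f (M *m x) = \int[mu n]_x f x)%E.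

Let scalesM n (M N : 'M[R]_n) : scales M -> scales N -> scales (M *m N).
Proof.
move=> sM sN f mf f0; rewrite det_mulmx normrM EFinM -(sM f)// -muleA.
congr (_ * _)%E; rewrite -(sN (fun x => f (M *m x)))//; last first.
  exact: (measurableT_comp mf (measurable_fun_mulmx M)).
by congr (_ * _)%E; apply: eq_integral => x _; rewrite mulmxA.
Qed.

Let mul_block_cons n (a : R) (r : 'rV[R]_n) (c : 'cV[R]_n) (N : 'M[R]_n) x y :
  (block_mx (a%:M : 'M[R]_1) r c N : 'M[R]_n.+1) *m consV (x, y) =
  consV (a * x + (r *m y) ord0 ord0, x *: c + N *m y).
Proof.
rewrite [LHS](mul_block_col (a%:M : 'M[R]_1) r c N (const_mx x) y).
apply: (@f_equal2 _ _ _ (@col_mx R 1 n 1)).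
  by apply/matrixP => i j; rewrite !ord1 mul_scalar_mx !mxE.
rewrite /=; congr (_ + _); apply/matrixP => i j; rewrite !mxE big_ord_recl big_ord0 !mxE addr0.
by rewrite !ord1 mulrC.
Qed.

Let mulmx_block1 n (a a' : 'M[R]_1) (r r' : 'rV[R]_n) c c' (N N' : 'M[R]_n) :
  (block_mx a r c N : 'M[R]_n.+1) *m (block_mx a' r' c' N' : 'M[R]_n.+1) =
  block_mx (a *m a' + r *m c') (a *m r' + r *m N')
           (c *m a' + N *m c') (c *m r' + N *m N').
Proof. exact: (@mulmx_block R 1 n 1 n 1). Qed.

Let scales_ushear n (r : 'rV[R]_n) :
  scales (block_mx (1%:M : 'M[R]_1) r 0 1%:M : 'M[R]_n.+1).
Proof.
move=> f mf f0; rewrite (det_ublock (1%:M : 'M[R]_1)) !det1 mulr1 normr1 mul1e.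
have mfM (M : 'M[R]_n.+1) : measurable_fun setT (fun x : 'cV[R]_n.+1 => f (M *m x)).
  exact: (measurableT_comp mf (measurable_fun_mulmx M)).
rewrite (integral_cVS (mfM _) (fun=> f0 _)) (integral_cVS mf f0); apply: eq_integral => y _.
have := ge0_integral_affine ((r *m y) ord0 ord0) (oner_neq0 R) (measurable_consV1 y mf).
move=> <- //; rewrite normr1 mul1e; apply: eq_integral => a _.
by rewrite mul_block_cons scaler0 add0r mul1mx.
Qed.

Let scales_lshear n (c : 'cV[R]_n) :
  scales (block_mx (1%:M : 'M[R]_1) 0 c 1%:M : 'M[R]_n.+1).
Proof.
move=> f mf f0; rewrite (det_lblock (1%:M : 'M[R]_1)) !det1 mulr1 normr1 mul1e.
have mfM (M : 'M[R]_n.+1) : measurable_fun setT (fun x : 'cV[R]_n.+1 => f (M *m x)).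
  exact: (measurableT_comp mf (measurable_fun_mulmx M)).
rewrite (integral_cVS_slices (mfM _) (fun=> f0 _)) (integral_cVS_slices mf f0).
apply: eq_integral => a _.
rewrite -(ge0_integral_shift (a *: c) (measurable_consV2 a mf))//.
apply: eq_integral => y _.
by rewrite mul_block_cons mul1r mul0mx mxE addr0 mul1mx addrC.
Qed.

Let scales_diag n (a : R) (N : 'M[R]_n) : a != 0 -> scales N ->
  scales (block_mx (a%:M : 'M[R]_1) 0 0 N : 'M[R]_n.+1).
Proof.
move=> a0 sN f mf f0.
have -> : \det (block_mx (a%:M : 'M[R]_1) 0 0 N : 'M[R]_n.+1) = a * \det N.
  by rewrite -[X in X * _]det_scalar1; exact: (@det_ublock R 1 n).
pose g y := (\int[lam]_x f (consV (x, y)))%E.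
have mg : measurable_fun setT g.
  apply: (measurable_fun_fubini_tonelli_G (fun p => f (consV p))) => //.
  exact: measurable_fun_cons.
have g0 y : (0 <= g y)%E by exact: integral_ge0.
have mfM (M : 'M[R]_n.+1) : measurable_fun setT (fun x : 'cV[R]_n.+1 => f (M *m x)).
  exact: (measurableT_comp mf (measurable_fun_mulmx M)).
rewrite (integral_cVS (mfM _) (fun=> f0 _)) (integral_cVS mf f0) -[RHS](sN g mg g0).
rewrite normrM mulrC EFinM -muleA.
congr (_ * _)%E; rewrite -ge0_integralZl//; last 2 first.
- apply: (measurable_fun_fubini_tonelli_G
    (fun p : measurableTypeR R * 'cV[R]_n =>
      f (block_mx (a%:M : 'M[R]_1) 0 0 N *m consV p))) => //.
  apply: (measurable_fun_cons (f := fun x => f (block_mx (a%:M : 'M[R]_1) 0 0 N *m x))).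
  exact: (mfM (block_mx (a%:M : 'M[R]_1) 0 0 N)).
- by move=> y _; exact: integral_ge0.
apply: eq_integral => y _; rewrite /g.
rewrite -(ge0_integral_affine 0 a0 (measurable_consV1 (N *m y) mf))//.
congr (_ * _)%E; apply: eq_integral => x _.
by rewrite mul_block_cons scaler0 add0r mul0mx mxE.
Qed.

(* A shear makes the corner entry nonzero; one step of Gaussian elimination    *)
(* then factors M into shears and a block diagonal matrix.                     *)
Lemma ge0_integral_mulmx n (M : 'M[R]_n) (f : 'cV[R]_n -> \bar R) :
  M \in unitmx -> measurable_fun setT f -> (forall x, 0 <= f x)%E ->
  (`|\det M|%:E * \int[mu n]_x f (M *m x) = \int[mu n]_x f x)%E.
Proof.
move=> uM; suff : scales M by move=> /[apply]/[apply].
elim: n M uM {f} => [|n IH] M uM.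
  move=> f mf f0; rewrite det_mx00 normr1 mul1e; apply: eq_integral => x _.
  by congr f; apply/colP => -[].
have pivot (N : 'M[R]_n.+1) : N \in unitmx -> N ord0 ord0 != 0 -> scales N.
  move=> uN N0; pose N' : 'M[R]_(1 + n) := N; pose a := N ord0 ord0.
  pose Schur := drsubmx N' - a^-1 *: (dlsubmx N' *m ursubmx N').
  have aE : ulsubmx N' = a%:M.
    by apply/matrixP => i j; rewrite !ord1 !mxE mulr1n; congr (N _ _); exact/val_inj.
  have NE : N = (block_mx (1%:M : 'M[R]_1) 0 (a^-1 *: dlsubmx N') 1%:M : 'M[R]_n.+1)
     *m (block_mx (a%:M : 'M[R]_1) 0 0 Schur : 'M[R]_n.+1)
     *m (block_mx (1%:M : 'M[R]_1) (a^-1 *: ursubmx N') 0 1%:M : 'M[R]_n.+1).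
    rewrite !mulmx_block1 !(mul1mx, mulmx1, mul0mx, mulmx0, addr0, add0r).
    rewrite -[LHS](submxK N') aE.
    apply: (f_equal4 (@block_mx R 1 n 1 n)) => //.
    - by rewrite mul_scalar_mx scalerA divff// scale1r.
    - by rewrite mul_mx_scalar scalerA divff// scale1r.
    - rewrite mul_mx_scalar scalerA divff// scale1r -scalemxAr.
      by rewrite /Schur addrC subrK.
  have uS : Schur \in unitmx.
    move: uN; rewrite NE !unitmx_mul => /andP[/andP[_]].
    by rewrite unitmxE (det_ublock (a%:M : 'M[R]_1)) unitrM => /andP[_]; rewrite -unitmxE.
  rewrite NE; apply: scalesM; last exact: scales_ushear.
  by apply: scalesM; [exact: scales_lshear|apply: scales_diag => //; exact: IH].
have [M0|] := eqVneq (M ord0 ord0) 0; last exact: pivot.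
have [k Mk] : exists k : 'I_n, M (lift ord0 k) ord0 != 0.
  apply/existsP; apply: contraT; rewrite negb_exists => /forallP Mk.
  have : (\det M == 0); last by move: uM; rewrite unitmxE unitfE => /negPf ->.
  rewrite (expand_det_col _ ord0) big1// => i _.
  case: (unliftP ord0 i) => [j ->|->]; last by rewrite M0 mul0r.
  by have /negPn/eqP -> := Mk j; rewrite mul0r.
(* [S d] adds the row of the nonzero entry to the first row, whose first entry is 0, and so places
   that entry in the corner. *)
pose S (r : 'rV[R]_n) : 'M[R]_n.+1 := block_mx (1%:M : 'M[R]_1) r 0 1%:M.
have SK r : S (- r) *m S r = 1%:M.
  rewrite /S mulmx_block1 !(mul1mx, mulmx1, mul0mx, mulmx0, addr0, add0r).
  by rewrite subrr -scalar_mx_block.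
have uS r : S r \in unitmx by rewrite unitmxE (det_ublock (1%:M : 'M[R]_1)) !det1 mulr1 unitr1.
pose d := (delta_mx 0 k : 'rV[R]_n).
rewrite -[M]mul1mx -(SK d) -mulmxA; apply: scalesM; first exact: scales_ushear.
apply: pivot; first by rewrite unitmx_mul uS.
suff -> : (S d *m M) ord0 ord0 = M (lift ord0 k) ord0 by [].
have Sd j : S d ord0 (lift ord0 j) = (j == k)%:R.
  rewrite (_ : lift ord0 j = rshift 1 j); last exact/val_inj.
  rewrite (_ : ord0 = lshift n (ord0 : 'I_1)); last exact/val_inj.
  by rewrite (@block_mxEur _ 1 n 1 n) mxE eqxx.
have Sd0 : S d ord0 ord0 = 1.
  rewrite (_ : ord0 = lshift n (ord0 : 'I_1)); last exact/val_inj.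
  by rewrite (@block_mxEul _ 1 n 1 n) mxE eqxx.
rewrite mxE big_ord_recl Sd0 M0 mulr0 add0r (bigD1 k)//= Sd eqxx mul1r.
by rewrite big1 ?addr0// => j /negPf jk; rewrite Sd jk mul0r.
Qed.

End lebesgue_cV_mulmx.

(** * Lattice sums and weights *)

Section countable_esum.
Local Open Scope ereal_scope.
Context {R : realType} {T : countType}.
Implicit Types a : T -> \bar R.

(** Turns a sum over a countable type into a series over [nat], padded with 0 at the integers that
    code nothing, so that monotone convergence for series applies. *)
Lemma esum_pickle a : (forall k, 0 <= a k) ->
  \esum_(k in [set: T]) a k = \sum_(n <oo) oapp a 0 (pickle_inv n).
Proof.
move=> a0; rewrite nneseries_esumT; last by move=> n; case: pickle_inv => /=.
have inj : set_inj [set: T] (@pickle T).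
  by move=> x y _ _; exact: (pcan_inj (@pickleK T)).
transitivity (\esum_(n in pickle @` [set: T]) oapp a 0 (pickle_inv n)).
  by rewrite (esum_image _ _ _ inj); apply: eq_esum => k _; rewrite pickleK_inv.
rewrite esum_mkcond; apply: eq_esum => n _; case: ifPn => // /negP nT.
case E : (pickle_inv n) => [k|//]; exfalso; apply: nT; rewrite inE; exists k => //.
by have := @pickle_invK T n; rewrite /ocancel E.
Qed.

Context {d : measure_display} {X : measurableType d}.
Variable mu : {measure set X -> \bar R}.

Lemma measurable_fun_esum (f : T -> X -> \bar R) :
  (forall k, measurable_fun setT (f k)) -> (forall k x, 0 <= f k x) ->
  measurable_fun setT (fun x => \esum_(k in [set: T]) f k x).
Proof.
move=> mf f0.
under eq_fun => x do rewrite esum_pickle//.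
apply: ge0_emeasurable_sum => [n x _ _|n _]; case: pickle_inv => [k|] //=.
Qed.

Lemma ge0_integral_esum (f : T -> X -> \bar R) :
  (forall k, measurable_fun setT (f k)) -> (forall k x, 0 <= f k x) ->
  \int[mu]_x (\esum_(k in [set: T]) f k x) = \esum_(k in [set: T]) \int[mu]_x f k x.
Proof.
move=> mf f0.
rewrite esum_pickle; last by move=> k; exact: integral_ge0.
under eq_integral do rewrite esum_pickle//.
rewrite integral_nneseries//.
- apply: eq_eseriesr => n _; case: pickle_inv => [k|] //=.
  by rewrite integral0.
- by move=> n; case: pickle_inv.
- by move=> n x _; case: pickle_inv => /=.
Qed.

End countable_esum.

Lemma ge0_esumZl {R : realType} {T : countType} (a : T -> \bar R) (x : R) :
  0 <= x -> (forall k, 0 <= a k)%E ->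
  (\esum_(k in [set: T]) (x%:E * a k) = x%:E * \esum_(k in [set: T]) a k)%E.
Proof.
move=> x0 a0; rewrite !esum_pickle//; last by move=> k; rewrite mule_ge0// lee_fin.
rewrite -nneseriesZl; last by move=> n _; case: pickle_inv.
by apply: eq_eseriesr => n _; case: pickle_inv => //=; rewrite mule0.
Qed.

Section lattice_sums.
Context {R : realType} {d : nat}.
Local Notation V := 'cV[R]_d.
Local Notation mu := (lebesgue_cV R d).
Variable M : 'M[R]_d.
Implicit Types (k : 'cV[int]_d) (t v : V) (w f : V -> R).

Definition latv k : V := M *m map_mx intr k.

Lemma latvD k l : latv (k + l) = latv k + latv l.
Proof. by rewrite /latv map_mxD mulmxDr. Qed.

Lemma latvN k : latv (- k) = - latv k.
Proof. by rewrite /latv map_mxN mulmxN. Qed.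

Lemma latv0 : latv 0 = 0.
Proof. by rewrite /latv map_mx0 mulmx0. Qed.

Lemma latvB k l : latv (k - l) = latv k - latv l.
Proof. by rewrite latvD latvN. Qed.

Definition lsum w t : \bar R := (\esum_(k in [set: 'cV[int]_d]) (w (t - latv k))%:E)%E.

Definition periodic_wrt f := forall t k, f (t + latv k) = f t.

Lemma measurable_shift_fun (f : V -> R) v : measurable_fun setT f ->
  measurable_fun setT (fun t => f (t + v)).
Proof. by move=> mf; exact: (measurableT_comp mf (measurable_fun_shift v)). Qed.

Lemma measurable_lsum w : measurable_fun setT w -> (forall t, 0 <= w t) ->
  measurable_fun setT (lsum w).
Proof.
move=> mw w0; apply: measurable_fun_esum => [k|k t]; last by rewrite lee_fin.
by apply/measurable_EFinP; exact: measurable_shift_fun.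
Qed.

Lemma lsum_ge0 w t : (forall t, 0 <= w t) -> (0 <= lsum w t)%E.
Proof. by move=> w0; apply: esum_ge0 => k _; rewrite lee_fin. Qed.

(** Integrate the lattice sum term by term. Translating the term of index [k] by a lattice vector
    does not affect the periodic [f] and moves the shift from one factor to the other, at the cost
    of replacing [k] by [- k]. *)
Lemma integral_lsum_swap f w1 w2 : periodic_wrt f ->
  measurable_fun setT f -> (forall t, 0 <= f t) ->
  measurable_fun setT w1 -> (forall t, 0 <= w1 t) ->
  measurable_fun setT w2 -> (forall t, 0 <= w2 t) ->
  (\int[mu]_t ((f t * w1 t)%:E * lsum w2 t) =
   \int[mu]_t ((f t * w2 t)%:E * lsum w1 t))%E.
Proof.
move=> pf mf f0 mw1 w10 mw2 w20.
have expand (u1 u2 : V -> R) : measurable_fun setT u1 -> (forall t, 0 <= u1 t) ->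
    measurable_fun setT u2 -> (forall t, 0 <= u2 t) ->
    (\int[mu]_t ((f t * u1 t)%:E * lsum u2 t) =
     \esum_(k in [set: 'cV[int]_d]) \int[mu]_t (f t * u1 t * u2 (t - latv k))%:E)%E.
  move=> mu1 u10 mu2 u20; rewrite -ge0_integral_esum//.
  - apply: eq_integral => t _; rewrite /lsum -ge0_esumZl ?mulr_ge0//.
    by move=> k; rewrite lee_fin.
  - move=> k; apply/measurable_EFinP; apply: measurable_funM.
      exact: measurable_funM.
    exact: measurable_shift_fun.
  - by move=> k t; rewrite lee_fin !mulr_ge0.
rewrite !expand// (reindex_esum [set: 'cV[int]_d] _ -%R).
  apply: eq_esum => k _.
  have -> : (\int[mu]_t (f t * w1 t * w2 (t - latv (- k)))%:E =
             \int[mu]_t (f (t + latv k) * w1 (t + latv k - latv k) * w2 (t + latv k))%:E)%E.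
    by apply: eq_integral => t _; rewrite pf addrK latvN opprK.
  rewrite (ge0_integral_shift (f := fun t => (f t * w1 (t - latv k) * w2 t)%:E)).
  - by apply: eq_integral => t _; rewrite mulrAC.
  - apply/measurable_EFinP; apply: measurable_funM => //.
    by apply: measurable_funM => //; exact: measurable_shift_fun.
  - by move=> t; rewrite lee_fin !mulr_ge0.
by split.
Qed.

Definition weight w := [/\ measurable_fun setT w, forall t, 0 <= w t &
  {ae mu, forall t, lsum w t = 1%E}].

(** Insert the factor [lsum M w = 1], exchange the roles of [w] and [w1], and bound the factor
    [lsum M w1] that appears by 1. *)
Lemma le_integral_weight f w1 w : periodic_wrt f ->
  measurable_fun setT f -> (forall t, 0 <= f t) -> weight w ->
  measurable_fun setT w1 -> (forall t, 0 <= w1 t) ->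
  {ae mu, forall t, (lsum w1 t <= 1)%E} ->
  (\int[mu]_t (f t * w1 t)%:E <= \int[mu]_t (f t * w t)%:E)%E.
Proof.
move=> pf mf f0 [mw w0 w1E] mw1 w10 le1.
have mM (u : V -> R) : measurable_fun setT u -> measurable_fun setT (fun t => (f t * u t)%:E).
  by move=> mu'; apply/measurable_EFinP; exact: measurable_funM.
have M0 (u : V -> R) t : (forall t, 0 <= u t) -> (0 <= (f t * u t)%:E)%E.
  by move=> u0; rewrite lee_fin mulr_ge0.
have mMl (u1 u2 : V -> R) : measurable_fun setT u1 -> measurable_fun setT u2 ->
    (forall t, 0 <= u2 t) -> measurable_fun setT (fun t => (f t * u1 t)%:E * lsum u2 t)%E.
  move=> mu1 mu2 u20; apply: emeasurable_funM; first exact: mM.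
  exact: measurable_lsum.
have Ml0 (u1 u2 : V -> R) t : (forall t, 0 <= u1 t) -> (forall t, 0 <= u2 t) ->
    (0 <= (f t * u1 t)%:E * lsum u2 t)%E.
  by move=> u10 u20; apply: mule_ge0; [exact: M0|exact: lsum_ge0].
have -> : (\int[mu]_t (f t * w1 t)%:E = \int[mu]_t ((f t * w1 t)%:E * lsum w t))%E.
  apply: ge0_ae_eq_integral => //.
  - exact: mM.
  - exact: mMl.
  - by move=> t _; exact: M0.
  - by move=> t _; exact: Ml0.
  - by apply: filterS w1E => t -> _; rewrite mule1.
rewrite integral_lsum_swap//; apply: ae_ge0_le_integral => //.
- by move=> t _; exact: Ml0.
- exact: mMl.
- by move=> t _; exact: M0.
- exact: mM.
- by apply: filterS le1 => t lt1 _; rewrite -[leRHS]mule1 lee_wpmul2l// M0.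
Qed.

Lemma eq_integral_weight f w1 w : periodic_wrt f ->
  measurable_fun setT f -> (forall t, 0 <= f t) -> weight w1 -> weight w ->
  (\int[mu]_t (f t * w1 t)%:E = \int[mu]_t (f t * w t)%:E)%E.
Proof.
move=> pf mf f0 ww1 ww; apply/eqP; rewrite eq_le; apply/andP; split.
  case: (ww1) => mw w0 w1E.
  by apply: le_integral_weight => //; apply: filterS w1E => t ->.
case: (ww) => mw w0 w1E.
by apply: le_integral_weight => //; apply: filterS w1E => t ->.
Qed.

Lemma negligible_shift (A : set V) v : mu.-negligible A ->
  mu.-negligible [set t | A (t + v)].
Proof.
move=> [N [mN N0 AN]]; exists [set t | N (t + v)]; split => [||t]; last exact: AN.
  by rewrite -[X in measurable X]setTI; exact: measurable_fun_shift.
have mN' : measurable [set t | N (t + v)].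
  by rewrite -[X in measurable X]setTI; exact: measurable_fun_shift.
have muE B : measurable B -> mu B = (\int[mu]_t (\1_B t)%:E)%E.
  by move=> mB; rewrite integral_indic// setIT.
rewrite muE// -[RHS]N0 muE// -[RHS](ge0_integral_shift v)//.
  by apply/measurable_EFinP; exact: measurable_indic.
Qed.

Lemma ae_shift (P : V -> Prop) v : {ae mu, forall t, P t} ->
  {ae mu, forall t, P (t + v)}.
Proof. exact: negligible_shift. Qed.

Lemma weight_shift w v : weight w -> weight (fun t => w (t + v)).
Proof.
move=> [mw w0 w1]; split => //; first exact: measurable_shift_fun.
apply: filterS (ae_shift v w1) => t <-.
by apply: eq_esum => k _; rewrite addrAC.
Qed.

End lattice_sums.

Section trigonometric_periods.
Variable R : realType.
Implicit Types (x : R) (z : int).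

Lemma cosD2piz x z : cos (x + 2 * pi * z%:~R) = cos x.
Proof.
have nat_case (y : R) n : cos (y + 2 * pi * n%:R) = cos y.
  elim: n y => [|n IH] y; first by rewrite mulr0 addr0.
  rewrite -[n.+1%:R]natr1 mulrDr mulr1 addrA -[RHS](IH y) -[in RHS]cosD2pi.
  by congr cos; rewrite mulr_natl.
case: z => n; first by rewrite -pmulrn nat_case.
rewrite NegzE mulrNz mulrN -(nat_case _ n.+1) -pmulrn.
by rewrite -addrA addNr addr0.
Qed.

Lemma sinD2piz x z : sin (x + 2 * pi * z%:~R) = sin x.
Proof. by rewrite -!cosBpihalf addrAC cosD2piz. Qed.

End trigonometric_periods.

Section dot_products.
Context {R : realType} {d : nat}.
Local Notation V := 'cV[R]_d.
Implicit Types u v t : V.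

Lemma dotvE u v : dotv u v = (u^T *m v) ord0 ord0.
Proof. by rewrite mxE; apply: eq_bigr => i _; rewrite mxE. Qed.

Lemma dotvDr u v t : dotv u (v + t) = dotv u v + dotv u t.
Proof. by rewrite !dotvE mulmxDr mxE. Qed.

Lemma dotvDl u v t : dotv (u + v) t = dotv u t + dotv v t.
Proof. by rewrite !dotvE linearD mulmxDl mxE. Qed.

Lemma dotvNl u t : dotv (- u) t = - dotv u t.
Proof. by rewrite !dotvE linearN mulNmx mxE. Qed.

Lemma dotvZr u v (a : R) : dotv u (a *: v) = a * dotv u v.
Proof. by rewrite !dotvE -scalemxAr mxE. Qed.

Lemma dotvv_gt0 u : u != 0 -> 0 < dotv u u.
Proof.
move=> u0; rewrite lt_def; apply/andP; split; last first.
  by apply: sumr_ge0 => i _; rewrite -expr2 sqr_ge0.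
apply: contra u0; rewrite psumr_eq0; last by move=> i _; rewrite -expr2 sqr_ge0.
move=> /allP h; apply/eqP/colP => i; rewrite mxE.
by have := h i (mem_index_enum i); rewrite /= mulf_eq0 orbb => /eqP.
Qed.

Lemma measurable_dotv u : measurable_fun setT (dotv u).
Proof.
apply: measurable_sum => i; apply: measurable_funM => //.
exact: (measurable_cV_coord i).
Qed.

End dot_products.

(** * Integrals of constants and characters against weights *)

Section weight_integrals.
Context {R : realType} {d : nat}.
Local Notation V := 'cV[R]_d.
Local Notation mu := (lebesgue_cV R d).
Variable M : 'M[R]_d.
Implicit Types (k : 'cV[int]_d) (t v : V) (w f : V -> R).

(** The half-open parallelepiped spanned by the columns of [M]: for invertible [M] it tiles exactly
    at every point, and it is the weight against which all others are compared. *)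
Definition cell : set V := [set t | forall i, (invmx M *m t) i ord0 \in `[0, 1[].

Lemma measurable_coord_box (A : 'I_d -> set R) : (forall i, measurable (A i)) ->
  measurable [set t : V | forall i, A i (t i ord0)].
Proof.
move=> mA.
rewrite (_ : [set t | _] = \big[setI/setT]_(i < d) (cV_coord i @^-1` A i)).
  apply: bigsetI_measurable => i _; rewrite -[X in measurable X]setTI.
  exact: measurable_cV_coord.
rewrite -bigcap_seq; apply/seteqP; split=> x /= h i.
  by move=> _; exact: h.
exact: (h i (mem_index_enum i)).
Qed.

Lemma measurable_cell : measurable cell.
Proof.
rewrite (_ : cell = mulmx (invmx M) @^-1`
  [set t : V | forall i, `[0, 1[%classic (t i ord0)])//.
rewrite -[X in measurable X]setTI; apply: measurable_fun_mulmx => //.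
by apply: (@measurable_coord_box (fun=> `[0, 1[%classic)).
Qed.

Hypothesis uM : M \in unitmx.

Lemma cellP t k : cell (t - latv M k) <->
  k = \col_i Num.floor ((invmx M *m t) i ord0).
Proof.
have E i : (invmx M *m (t - latv M k)) i ord0 =
    (invmx M *m t) i ord0 - (k i ord0)%:~R.
  by rewrite mulmxBr /latv mulKmx// !mxE.
split=> [h|kE].
  apply/colP => i; rewrite mxE; apply/esym/floor_def.
  have := h i; rewrite E in_itv/= subr_ge0 => /andP[-> /=].
  by rewrite ltrBlDr addrC intrD.
move=> i; rewrite E kE mxE in_itv/= subr_ge0 floor_le/= ltrBlDr addrC.
by have /andP[_] := floor_itv ((invmx M *m t) i ord0); rewrite intrD.
Qed.

Lemma lsum_indic_unique (A : set V) t k0 :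
  (forall k, A (t - latv M k) <-> k = k0) -> lsum M \1_A t = 1%E.
Proof.
move=> Ak.
transitivity (\esum_(k in [set k0]) (1%E : \bar R))%E; last by rewrite esum_set1.
rewrite esum_mkcond; apply: eq_esum => k _; rewrite indicE.
have [kk|kk] := pselect (k = k0).
  by rewrite (mem_set (_ : [set k0] k))// mem_set//; exact/Ak.
by rewrite (memNset (_ : ~ [set k0] k))// memNset// => /Ak.
Qed.

Lemma weight_cell : weight M (\1_cell).
Proof.
split => //; first by apply: measurable_indic; exact: measurable_cell.
by apply: aeW => t; apply: lsum_indic_unique => k; exact: cellP.
Qed.

Lemma integral_cell : (\int[mu]_t (\1_cell t)%:E = `|\det M|%:E)%E.
Proof.
rewrite -(ge0_integral_mulmx uM)//; last first.
  by apply/measurable_EFinP; apply: measurable_indic; exact: measurable_cell.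
rewrite -[RHS]mule1; congr (_ * _)%E.
pose B := [set x : V | forall i, (`[0, 1[%classic : set R) (x i ord0)].
have mB : measurable B by exact: (@measurable_coord_box (fun=> `[0, 1[%classic)).
transitivity (mu B).
  transitivity (\int[mu]_x (\1_B x)%:E)%E; last by rewrite integral_indic// setIT.
  apply: eq_integral => x _; congr EFin; rewrite !indicE.
  rewrite (_ : (M *m x \in cell) = (x \in B))//.
  apply/idP/idP => /set_mem h; apply/mem_set => i; have := h i.
    by rewrite mulKmx.
  by rewrite mulKmx.
rewrite (lebesgue_cV_box (A := fun=> `[0, 1[%classic))// big1// => i _.
by rewrite lebesgue_measure_itv/= lte01 sube0.
Qed.

(** The constant 1 is periodic, so every weight has the integral of the cell, which a change of
    variables computes on the unit cube. *)
Lemma integral_weight w : weight M w -> (\int[mu]_t (w t)%:E = `|\det M|%:E)%E.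
Proof.
move=> ww; rewrite -integral_cell.
have := @eq_integral_weight R d M (cst 1) w \1_cell _ _ _ ww weight_cell.
rewrite /periodic_wrt.
do 3 move=> /(_ _)/wrap[]//.
by under eq_integral do rewrite mul1r; move=> ->; under eq_integral do rewrite mul1r.
Qed.

Lemma integrable_weight w : weight M w -> mu.-integrable setT (EFin \o w).
Proof.
move=> ww; have [mw w0 _] := ww.
apply/integrableP; split; first exact/measurable_EFinP.
under eq_integral do rewrite /= ger0_norm//.
by rewrite integral_weight// ltry.
Qed.

Lemma integrable_mul_weight f w : weight M w -> measurable_fun setT f ->
  (forall t, `|f t| <= 1) -> mu.-integrable setT (EFin \o (fun t => f t * w t)).
Proof.
move=> ww mf f1; have [mw w0 _] := ww.
apply: le_integrable (integrable_weight ww) => //.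
  by apply/measurable_EFinP; exact: measurable_funM.
by move=> t _ /=; rewrite lee_fin normrM ler_piMl.
Qed.

(* Comparing the weights w and w(. - v) on 1 + f >= 0 gives                    *)
(* int (1 + f) w = int (1 - f) w.                                              *)
Lemma Rintegral_antiperiodic f w v : weight M w -> periodic_wrt M f ->
  measurable_fun setT f -> (forall t, `|f t| <= 1) ->
  (forall t, f (t + v) = - f t) -> \int[mu]_t (f t * w t) = 0.
Proof.
move=> ww pf mf f1 fv; have [mw w0 _] := ww.
have iw := integrable_weight ww.
have ifw := integrable_mul_weight ww mf f1.
have f_ge t : 0 <= 1 + f t.
  by have := f1 t; rewrite ler_norml => /andP[+ _]; rewrite -subr_ge0 opprK addrC.
have m1f : measurable_fun setT (fun t => 1 + f t) by exact: measurable_funD.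
have := @eq_integral_weight R d M (fun t => 1 + f t) w _ _ m1f f_ge ww (weight_shift (- v) ww).
move=> /(_ _)/wrap[]; first by move=> t k; rewrite pf.
have -> : (\int[mu]_t ((1 + f t) * w (t - v))%:E = \int[mu]_t ((1 - f t) * w t)%:E)%E.
  rewrite -(ge0_integral_shift v (f := fun t => ((1 + f t) * w (t - v))%:E)).
  - by apply: eq_integral => t _; rewrite addrK fv.
  - apply/measurable_EFinP; apply: measurable_funM => //.
    exact: measurable_shift_fun.
  - by move=> t; rewrite lee_fin mulr_ge0.
move=> /(congr1 fine).
rewrite -[fine (\int[mu]_t ((1 + f t) * w t)%:E)%E]/(\int[mu]_t ((1 + f t) * w t)).
rewrite -[fine (\int[mu]_t ((1 - f t) * w t)%:E)%E]/(\int[mu]_t ((1 - f t) * w t)).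
under eq_Rintegral do rewrite mulrDl mul1r.
rewrite RintegralD//.
under [in RHS]eq_Rintegral do rewrite mulrBl mul1r.
rewrite RintegralB// => /addrI h.
by lra.
Qed.

(** Membership in the dual lattice: exactly what makes the character of frequency [v] periodic. *)
Definition dual_vector v := forall k, exists z : int, dotv v (latv M k) = z%:~R.

Lemma periodic_cos v : dual_vector v ->
  periodic_wrt M (fun t => cos (2 * pi * dotv v t)).
Proof.
by move=> dv t k; have [z zE] := dv k; rewrite dotvDr zE mulrDr cosD2piz.
Qed.

Lemma periodic_sin v : dual_vector v ->
  periodic_wrt M (fun t => sin (2 * pi * dotv v t)).
Proof.
by move=> dv t k; have [z zE] := dv k; rewrite dotvDr zE mulrDr sinD2piz.
Qed.

Lemma measurable_cos_dotv v : measurable_fun setT (fun t => cos (2 * pi * dotv v t)).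
Proof.
have mc : measurable_fun setT (@cos R).
  by apply: continuous_measurable_fun; exact: continuous_cos.
apply: (measurableT_comp mc).
by apply: measurable_funM => //; exact: measurable_dotv.
Qed.

Lemma measurable_sin_dotv v : measurable_fun setT (fun t => sin (2 * pi * dotv v t)).
Proof.
have mc : measurable_fun setT (@sin R).
  by apply: continuous_measurable_fun; exact: continuous_sin.
apply: (measurableT_comp mc).
by apply: measurable_funM => //; exact: measurable_dotv.
Qed.

Lemma norm_cos_le1 (x : R) : `|cos x| <= 1.
Proof. by rewrite ler_norml cos_geN1 cos_le1. Qed.

Lemma norm_sin_le1 (x : R) : `|sin x| <= 1.
Proof. by rewrite ler_norml sin_geN1 sin_le1. Qed.

(** Translating by such a [u] advances the phase by [pi], which changes the sign of both cosine and
    sine. *)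
Let half_period v : v != 0 -> exists u, dotv v u = 2^-1.
Proof.
move=> v0; exists ((2 * dotv v v)^-1 *: v); rewrite dotvZr.
by field; rewrite gt_eqF// dotvv_gt0.
Qed.

Lemma Rintegral_cos_weight v w : v != 0 -> dual_vector v -> weight M w ->
  \int[mu]_t (cos (2 * pi * dotv v t) * w t) = 0.
Proof.
move=> v0 dv ww; have [u uE] := half_period v0.
apply: (Rintegral_antiperiodic (v := u)) => //.
- exact: periodic_cos.
- exact: measurable_cos_dotv.
- by move=> t; exact: norm_cos_le1.
- move=> t; rewrite dotvDr uE -cosDpi; congr cos; by field.
Qed.

Lemma Rintegral_sin_weight v w : v != 0 -> dual_vector v -> weight M w ->
  \int[mu]_t (sin (2 * pi * dotv v t) * w t) = 0.
Proof.
move=> v0 dv ww; have [u uE] := half_period v0.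
apply: (Rintegral_antiperiodic (v := u)) => //.
- exact: periodic_sin.
- exact: measurable_sin_dotv.
- by move=> t; exact: norm_sin_le1.
- move=> t; rewrite dotvDr uE -sinDpi; congr sin; by field.
Qed.

End weight_integrals.

(** * Trigonometric approximation in mean square *)

Section squared_modulus.
Variable R : rcfType.
Implicit Types z w : R[i].

Definition sqn z : R := complex.Re z ^+ 2 + complex.Im z ^+ 2.

Lemma sqn_ge0 z : 0 <= sqn z.
Proof. by rewrite addr_ge0// sqr_ge0. Qed.

Lemma sqnM z w : sqn (z * w) = sqn z * sqn w.
Proof. by case: z => a b; case: w => x y; rewrite /sqn /=; ring. Qed.

Lemma sqnN z : sqn (- z) = sqn z.
Proof. by case: z => a b; rewrite /sqn /= !sqrrN. Qed.

Lemma sqn_real (x : R) : sqn (Complex x 0) = x ^+ 2.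
Proof. by rewrite /sqn /= expr0n addr0. Qed.

(** Parallelogram law: the two sides differ by the squared modulus of [z - w]. This replaces the
    triangle inequality for squared distances. *)
Lemma sqnD_le z w : sqn (z + w) <= 2 * sqn z + 2 * sqn w.
Proof.
case: z => a b; case: w => x y; rewrite /sqn /= -subr_ge0.
have -> : 2 * (a ^+ 2 + b ^+ 2) + 2 * (x ^+ 2 + y ^+ 2) -
  ((a + x) ^+ 2 + (b + y) ^+ 2) = (a - x) ^+ 2 + (b - y) ^+ 2 by ring.
by rewrite addr_ge0// sqr_ge0.
Qed.

Lemma normc_sqr z : ComplexField.Normc.normc z ^+ 2 = sqn z.
Proof. by case: z => a b; rewrite /= sqr_sqrtr// addr_ge0// sqr_ge0. Qed.

Lemma ReM z w : complex.Re (z * w) = complex.Re z * complex.Re w - complex.Im z * complex.Im w.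
Proof. by case: z => a b; case: w. Qed.

Lemma ImM z w : complex.Im (z * w) = complex.Re z * complex.Im w + complex.Im z * complex.Re w.
Proof. by case: z => a b; case: w. Qed.

Lemma Re_conjc z : complex.Re (conjc z) = complex.Re z.
Proof. by case: z. Qed.

Lemma Im_conjc z : complex.Im (conjc z) = - complex.Im z.
Proof. by case: z. Qed.

Lemma conjcM z w : conjc (z * w) = conjc z * conjc w.
Proof.
case: z => a b; case: w => x y; apply/eqP; rewrite eq_complex ReM ImM /=.
by apply/andP; split; apply/eqP; ring.
Qed.

Lemma conjc_Complex0 (x : R) : conjc (Complex x 0) = Complex x 0 :> R[i].
Proof. by rewrite /= oppr0. Qed.

Lemma sqn_conjc z : sqn (conjc z) = sqn z.
Proof. by rewrite /sqn Re_conjc Im_conjc sqrrN. Qed.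

Lemma ReD z w : complex.Re (z + w) = complex.Re z + complex.Re w.
Proof. by case: z => a b; case: w. Qed.

Lemma ImD z w : complex.Im (z + w) = complex.Im z + complex.Im w.
Proof. by case: z => a b; case: w. Qed.

Lemma ReN z : complex.Re (- z) = - complex.Re z.
Proof. by case: z. Qed.

Lemma ImN z : complex.Im (- z) = - complex.Im z.
Proof. by case: z. Qed.

Lemma complex_realM (a b : R) : Complex a 0 * Complex b 0 = Complex (a * b) 0 :> R[i].
Proof. by apply/eqP; rewrite eq_complex ReM ImM /= !mulr0 mul0r subr0 addr0 !eqxx. Qed.

Lemma complex_realD (a b : R) : Complex a 0 + Complex b 0 = Complex (a + b) 0 :> R[i].
Proof. by apply/eqP; rewrite eq_complex ReD ImD /= addr0 !eqxx. Qed.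

End squared_modulus.

Section complex_measurable.
Context {R : realType} {d : measure_display} {X : measurableType d}.
Implicit Types h g : X -> R[i].

Definition cmeasurable h := measurable_fun setT (fun t => complex.Re (h t)) /\
  measurable_fun setT (fun t => complex.Im (h t)).

Lemma cmeasurable_cst (z : R[i]) : cmeasurable (fun=> z).
Proof. by split. Qed.

Lemma cmeasurableD h g : cmeasurable h -> cmeasurable g ->
  cmeasurable (fun t => h t + g t).
Proof.
move=> [h1 h2] [g1 g2]; split.
  by under eq_fun do rewrite ReD; exact: measurable_funD.
by under eq_fun do rewrite ImD; exact: measurable_funD.
Qed.

Lemma cmeasurableN h : cmeasurable h -> cmeasurable (fun t => - h t).
Proof.
move=> [h1 h2]; split.
  by under eq_fun do rewrite ReN; exact: measurable_funN.
by under eq_fun do rewrite ImN; exact: measurable_funN.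
Qed.

Lemma cmeasurableB h g : cmeasurable h -> cmeasurable g ->
  cmeasurable (fun t => h t - g t).
Proof. by move=> mh mg; apply: cmeasurableD => //; exact: cmeasurableN. Qed.

Lemma cmeasurableM h g : cmeasurable h -> cmeasurable g ->
  cmeasurable (fun t => h t * g t).
Proof.
move=> [h1 h2] [g1 g2]; split.
  by under eq_fun do rewrite ReM; apply: measurable_funB; exact: measurable_funM.
by under eq_fun do rewrite ImM; apply: measurable_funD; exact: measurable_funM.
Qed.

Lemma cmeasurable_conjc h : cmeasurable h -> cmeasurable (fun t => conjc (h t)).
Proof.
move=> [h1 h2]; split; first by under eq_fun do rewrite Re_conjc.
by under eq_fun do rewrite Im_conjc; exact: measurable_funN.
Qed.

Lemma cmeasurable_real (f : X -> R) : measurable_fun setT f ->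
  cmeasurable (fun t => Complex (f t) 0).
Proof. by split. Qed.

Lemma cmeasurable_sum I (s : seq I) (f : I -> X -> R[i]) :
  (forall i, cmeasurable (f i)) -> cmeasurable (fun t => \sum_(i <- s) f i t).
Proof.
move=> mf; elim: s => [|i s IH].
  by under eq_fun do rewrite big_nil; exact: cmeasurable_cst.
by under eq_fun do rewrite big_cons; exact: cmeasurableD.
Qed.

Lemma measurable_sqn h : cmeasurable h -> measurable_fun setT (fun t => sqn (h t)).
Proof.
by move=> [h1 h2]; apply: measurable_funD; exact: measurable_funX.
Qed.

Lemma measurable_sqnE h (F : set X) : cmeasurable h ->
  measurable_fun F (fun t => (sqn (h t))%:E).
Proof.
by move=> mh; apply/measurable_EFinP; apply: measurable_funTS; exact: measurable_sqn.
Qed.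

End complex_measurable.

(** * Mean-square approximation by combinations of characters *)

Section approximation.
Context {R : realType} {d : measure_display} {X : measurableType d}.
Variables (mu : {measure set X -> \bar R}) (F : set X).
Hypothesis mF : measurable F.
Variables (I : zmodType) (e : I -> X -> R[i]).
Hypothesis me : forall k, cmeasurable (e k).
Hypothesis sqn_e : forall k t, sqn (e k t) = 1.
Hypothesis e0 : forall t, e 0 t = 1.
Hypothesis eD : forall k l t, e (k + l) t = e k t * e l t.
Implicit Types (h g : X -> R[i]) (s : seq (I * R[i])) (u v : X -> R).

(** A list of frequencies with coefficients. Repetitions are allowed, so that a sum of polynomials
    is a concatenation; [tpoly_uniq] merges them when orthogonality is used. *)
Definition tpoly s t := \sum_(x <- s) x.2 * e x.1 t.

Definition dist2 h g : \bar R := (\int[mu]_(t in F) (sqn (h t - g t))%:E)%E.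

Definition approximable h :=
  forall eps : R, 0 < eps -> exists s, (dist2 h (tpoly s) <= eps%:E)%E.

Lemma cmeasurable_tpoly s : cmeasurable (tpoly s).
Proof.
by apply: cmeasurable_sum => -[k c]; apply: cmeasurableM => //; exact: cmeasurable_cst.
Qed.

Lemma dist2_le h g f : cmeasurable h -> cmeasurable g -> cmeasurable f ->
  (dist2 h f <= 2%:E * dist2 h g + 2%:E * dist2 g f)%E.
Proof.
move=> mh mg mf; have mB h1 h2 : cmeasurable h1 -> cmeasurable h2 ->
    measurable_fun F (fun t => (sqn (h1 t - h2 t))%:E).
  by move=> m1 m2; apply: measurable_sqnE; exact: cmeasurableB.
have B0 h1 h2 t : (0 <= (sqn (h1 t - h2 t))%:E)%E by rewrite lee_fin sqn_ge0.
have Z0 h1 h2 t : (0 <= 2%:E * (sqn (h1 t - h2 t))%:E)%E.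
  by rewrite -EFinM lee_fin mulr_ge0// sqn_ge0.
have mZ h1 h2 : cmeasurable h1 -> cmeasurable h2 ->
    measurable_fun F (fun t => 2%:E * (sqn (h1 t - h2 t))%:E)%E.
  by move=> m1 m2; apply: emeasurable_funM => //; exact: mB.
rewrite /dist2 -!ge0_integralZl//; try exact: mB.
rewrite -ge0_integralD//; try exact: mZ.
apply: ge0_le_integral => //.
- exact: mB.
- by apply: emeasurable_funD; exact: mZ.
- move=> t _; rewrite -!EFinM -EFinD lee_fin (le_trans _ (sqnD_le _ _))//.
  by rewrite addrA subrK.
Qed.

Lemma approximable_lim h : cmeasurable h ->
  (forall eps : R, 0 < eps -> exists g, [/\ cmeasurable g, approximable g &
     (dist2 h g <= eps%:E)%E]) -> approximable h.
Proof.
(* There are two errors and [dist2_le] doubles each, whence the quarter. *)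
move=> mh hl eps eps0; have e4 : 0 < eps / 4 by rewrite divr_gt0.
have [g [mg ag hg]] := hl _ e4; have [s gs] := ag _ e4; exists s.
apply: le_trans (dist2_le mh mg (cmeasurable_tpoly s)) _.
have -> : eps%:E = (2%:E * (eps / 4)%:E + 2%:E * (eps / 4)%:E)%E.
  by rewrite -!EFinM -EFinD; congr EFin; field.
by rewrite leeD// lee_wpmul2l.
Qed.

Lemma approximableD h g : cmeasurable h -> cmeasurable g ->
  approximable h -> approximable g -> approximable (fun t => h t + g t).
Proof.
move=> mh mg ah ag eps eps0; have e4 : 0 < eps / 4 by rewrite divr_gt0.
have [s1 hs] := ah _ e4; have [s2 gs] := ag _ e4; exists (s1 ++ s2).
pose f t := tpoly s1 t + g t.
have mf : cmeasurable f by apply: cmeasurableD => //; exact: cmeasurable_tpoly.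
apply: le_trans (dist2_le (cmeasurableD mh mg) mf (cmeasurable_tpoly _)) _.
have -> : dist2 (fun t => h t + g t) f = dist2 h (tpoly s1).
  by apply: eq_integral => t _; rewrite /f /= opprD addrACA subrr addr0.
have -> : dist2 f (tpoly (s1 ++ s2)) = dist2 g (tpoly s2).
  by apply: eq_integral => t _; rewrite /f /tpoly big_cat/= opprD addrACA subrr add0r.
have -> : eps%:E = (2%:E * (eps / 4)%:E + 2%:E * (eps / 4)%:E)%E.
  by rewrite -!EFinM -EFinD; congr EFin; field.
by rewrite leeD// lee_wpmul2l.
Qed.

Lemma approximableMe h (c : R[i]) k : cmeasurable h ->
  approximable h -> approximable (fun t => c * e k t * h t).
Proof.
(* Multiplying by [c * e k t] scales the squared distance by [sqn c]; the [+ 1] keeps [C] invertible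
   when [c] is 0. The character itself only shifts the frequencies of the polynomial. *)
move=> mh ah eps eps0; pose C := sqn c + 1.
have C0 : 0 < C by rewrite ltr_wpDl// sqn_ge0.
have [s hs] := ah (eps / C) (divr_gt0 eps0 C0).
exists [seq (k + x.1, c * x.2) | x <- s].
apply: (@le_trans _ _ (C%:E * dist2 h (tpoly s))%E); last first.
  apply: (le_trans (lee_wpmul2l _ hs)); first by rewrite lee_fin ltW.
  by rewrite -EFinM mulrC divfK// gt_eqF.
have mB : measurable_fun F (fun t => (sqn (h t - tpoly s t))%:E).
  by apply: measurable_sqnE; apply: cmeasurableB => //; exact: cmeasurable_tpoly.
have B0 t : (0 <= (sqn (h t - tpoly s t))%:E)%E by rewrite lee_fin sqn_ge0.
rewrite /dist2 -ge0_integralZl//; last by rewrite lee_fin ltW.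
apply: ge0_le_integral => //.
- by move=> t _; rewrite lee_fin sqn_ge0.
- apply: measurable_sqnE; apply: cmeasurableB; last exact: cmeasurable_tpoly.
  by apply: cmeasurableM => //; apply: cmeasurableM => //; exact: cmeasurable_cst.
- by apply: emeasurable_funM.
- move=> t _; rewrite -EFinM lee_fin.
  have -> : tpoly [seq (k + x.1, c * x.2) | x <- s] t = c * e k t * tpoly s t.
    rewrite /tpoly big_map/= mulr_sumr; apply: eq_bigr => x _.
    by rewrite eD mulrACA.
  by rewrite -mulrBr !sqnM sqn_e mulr1 ler_wpM2r ?sqn_ge0// lerDl.
Qed.

Lemma approximableZ h (c : R[i]) : cmeasurable h ->
  approximable h -> approximable (fun t => c * h t).
Proof.
move=> mh /(approximableMe c 0 mh); congr approximable; apply/funext => t.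
by rewrite e0 mulr1.
Qed.

Lemma approximable1 : approximable (fun=> 1).
Proof.
move=> eps eps0; exists [:: (0, 1)]; rewrite /dist2 integral0_eq ?lee_fin 1?ltW//.
by move=> t _; rewrite /tpoly big_seq1/= e0 mul1r subrr /sqn /= !expr0n addr0.
Qed.

Definition square_integrable h :=
  cmeasurable h /\ (\int[mu]_(t in F) (sqn (h t))%:E < +oo)%E.

(** The condition ranges over all approximable [h], so products of multipliers are handled by
    composition, whereas approximability alone gives no hold on a product. *)
Definition multiplier u := [/\ measurable_fun setT u, exists C, forall t, `|u t| <= C &
  forall h, square_integrable h -> approximable h ->
    approximable (fun t => Complex (u t) 0 * h t)].

Lemma square_integrableM u h : measurable_fun setT u -> (exists C, forall t, `|u t| <= C) ->
  square_integrable h -> square_integrable (fun t => Complex (u t) 0 * h t).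
Proof.
move=> mu_ [C uC] [mh h2].
have mc : cmeasurable (fun t => Complex (u t) 0 * h t).
  by apply: cmeasurableM => //; exact: cmeasurable_real.
split => //.
apply: (@le_lt_trans _ _ ((C ^+ 2)%:E * \int[mu]_(t in F) (sqn (h t))%:E)%E).
  rewrite -ge0_integralZl//.
  - apply: ge0_le_integral => //.
    + by move=> t _; rewrite lee_fin sqn_ge0.
    + exact: measurable_sqnE.
    + by apply: emeasurable_funM => //; exact: measurable_sqnE.
    + move=> t _; rewrite -EFinM lee_fin sqnM sqn_real ler_wpM2r ?sqn_ge0//.
      by rewrite -real_normK ?num_real// lerXn2r ?nnegrE// (le_trans _ (uC t)).
  - exact: measurable_sqnE.
  - by move=> t _; rewrite lee_fin sqn_ge0.
  - by rewrite lee_fin sqr_ge0.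
by rewrite lte_mul_pinfty// lee_fin sqr_ge0.
Qed.

Lemma multiplierM u v : multiplier u -> multiplier v -> multiplier (fun t => u t * v t).
Proof.
move=> [mu_ bu au] [mv bv av]; split; first exact: measurable_funM.
  have [C uC] := bu; have [D vD] := bv; exists (C * D) => t.
  by rewrite normrM ler_pM.
move=> h h2 ah; have := au _ (square_integrableM mv bv h2) (av _ h2 ah).
congr approximable; apply/funext => t; rewrite mulrA; congr (_ * _).
by rewrite complex_realM.
Qed.

Lemma multiplierD u v : multiplier u -> multiplier v -> multiplier (fun t => u t + v t).
Proof.
move=> [mu_ bu au] [mv bv av]; split; first exact: measurable_funD.
  have [C uC] := bu; have [D vD] := bv; exists (C + D) => t.
  by rewrite (le_trans (ler_normD _ _))// lerD.
move=> h h2 ah.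
have [m1 _] := square_integrableM mu_ bu h2; have [m2 _] := square_integrableM mv bv h2.
have := approximableD m1 m2 (au _ h2 ah) (av _ h2 ah).
congr approximable; apply/funext => t; rewrite -mulrDl; congr (_ * _).
by rewrite complex_realD.
Qed.

Lemma multiplier_cst (a : R) : multiplier (fun=> a).
Proof.
split => //; first by exists `|a|.
by move=> h [mh _] ah; exact: approximableZ.
Qed.

Lemma multiplierX u n : multiplier u -> multiplier (fun t => u t ^+ n).
Proof.
move=> mu_; elim: n => [|n IH]; first exact: multiplier_cst.
by under eq_fun do rewrite exprS; exact: multiplierM.
Qed.

Lemma multiplierB u v : multiplier u -> multiplier v -> multiplier (fun t => u t - v t).
Proof.
move=> mu_ mv; have := multiplierD mu_ (multiplierM (multiplier_cst (-1)) mv).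
by congr multiplier; apply/funext => t; rewrite mulN1r.
Qed.

(** Dominated convergence turns the pointwise limit into a limit in mean square, to which
    [approximable_lim] applies. *)
Lemma approximable_dominated h (hn : nat -> X -> R[i]) (g : X -> R) :
  cmeasurable h -> (forall n, cmeasurable (hn n)) ->
  (forall n, approximable (hn n)) ->
  (forall t, sqn (h t - hn n t) @[n --> \oo] --> 0) ->
  mu.-integrable F (EFin \o g) ->
  (forall n t, sqn (h t - hn n t) <= g t) -> approximable h.
Proof.
move=> mh mhn ahn cv ig hg; apply: approximable_lim => // eps eps0.
have mB n : measurable_fun F (fun t => (sqn (h t - hn n t))%:E).
  by apply: measurable_sqnE; exact: cmeasurableB.
have cv0 : (\int[mu]_(t in F) (sqn (h t - hn n t))%:E)%E @[n --> \oo] --> 0%:E.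
  rewrite -[X in _ --> X](integral0 mu F); apply: (dominated_cvg mF mB _ _ ig) => //.
  - by move=> t _; apply: cvg_EFin; [exact: nearW|exact: cv].
  - by move=> n t _; rewrite gee0_abs lee_fin ?sqn_ge0//; exact: hg.
have /fine_cvgP[fin cvf] := cv0.
have [N _ /(_ N (leqnn N)) [finN ltN]] := filterI fin (cvgr_lt _ cvf _ eps0).
exists (hn N); split => //.
by rewrite /dist2 -(fineK finN) lee_fin ltW.
Qed.

Lemma multiplier_lim (un : nat -> X -> R) u (C : R) :
  measurable_fun setT u -> (forall n, multiplier (un n)) ->
  (forall n t, `|un n t| <= C) -> (forall t, un n t @[n --> \oo] --> u t) ->
  multiplier u.
Proof.
move=> mu_ mun unC cv.
have uC t : `|u t| <= C.
  have cn : `|un n t| @[n --> \oo] --> `|u t| by apply: cvg_norm; exact: cv.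
  rewrite -(cvg_lim (@Rhausdorff R) cn).
  have ic : cvgn (fun n => `|un n t|) by apply/cvg_ex; exists `|u t|.
  by apply: (limr_le ic); apply: nearW => n; exact: unC.
split => //; first by exists C.
move=> h [mh h2] ah.
(* The type [X] may be empty, so nonnegativity of [C] is available only in the presence of a
   point. *)
have C0 (t : X) : 0 <= C by apply: le_trans (uC t).
have mreal v : measurable_fun setT v -> cmeasurable (fun t => Complex (v t) 0 * h t).
  by move=> mv; apply: cmeasurableM => //; exact: cmeasurable_real.
have E n t : sqn (Complex (u t) 0 * h t - Complex (un n t) 0 * h t) =
    (u t - un n t) ^+ 2 * sqn (h t).
  rewrite -mulrBl -[in - _](opprK (Complex (un n t) 0)).
  have -> : - Complex (un n t) 0 = Complex (- un n t) 0.
    by apply/eqP; rewrite eq_complex ReN ImN /= oppr0 !eqxx.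
  by rewrite opprK complex_realD sqnM sqn_real.
apply: (@approximable_dominated _ (fun n t => Complex (un n t) 0 * h t)
  (fun t => (2 * C) ^+ 2 * sqn (h t))).
- exact: mreal.
- by move=> n; have [mn _ _] := mun n; exact: mreal.
- by move=> n; have [_ _ an] := mun n; exact: an.
- move=> t; under eq_fun do rewrite E.
  have -> : 0 = (u t - u t) ^+ 2 * sqn (h t) by rewrite subrr expr0n mul0r.
  apply: cvgMr_tmp; apply: (cvg_comp (fun n => u t - un n t) (fun x => x ^+ 2)).
    by apply: cvgB; [exact: cvg_cst|exact: cv].
  exact: exprn_continuous.
- under [X in integrable _ _ X]eq_fun do rewrite /= EFinM.
  apply: integrableZl => //; apply/integrableP; split; first exact: measurable_sqnE.
  by under eq_integral do rewrite gee0_abs ?lee_fin ?sqn_ge0//.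
- move=> n t; rewrite E ler_wpM2r ?sqn_ge0// -real_normK ?num_real//.
  rewrite lerXn2r ?nnegrE ?mulr_ge0// ?(C0 t)// (le_trans (ler_normB _ _))//.
  by rewrite mulr_natl mulr2n lerD.
Qed.

End approximation.

(** * Polynomials converging to a step function *)

Section real_powers.
Variable R : realType.
Implicit Types x z r y : R.

Lemma bernoulli_ge x n : -1 <= x -> 1 + n%:R * x <= (1 + x) ^+ n.
Proof.
move=> x1; elim: n => [|n IH]; first by rewrite mul0r addr0 expr0.
rewrite exprS; apply: (@le_trans _ _ ((1 + x) * (1 + n%:R * x))).
  rewrite -subr_ge0 -natr1.
  have -> : (1 + x) * (1 + n%:R * x) - (1 + (n%:R + 1) * x) = n%:R * x ^+ 2 by ring.
  by rewrite mulr_ge0// sqr_ge0.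
by rewrite ler_wpM2l// -lerBlDl sub0r.
Qed.

(** For [r > 0] and [s] its square root, Bernoulli bounds [n%:R * s ^+ n] by [(s^-1 - 1)^-1], and
    the remaining factor [s ^+ n] tends to 0. *)
Lemma cvg_natrM_expr r : 0 <= r < 1 -> (fun n => n%:R * r ^+ n) @ \oo --> (0 : R).
Proof.
move=> /andP[r0 r1]; have [->|rn0] := eqVneq r 0.
  apply: cvg_near_cst; exists 1%N => // n /= n0.
  by rewrite expr0n gtn_eqF// mulr0.
have rp : 0 < r by rewrite lt_def rn0.
pose s := Num.sqrt r.
have sp : 0 < s by rewrite sqrtr_gt0.
have s1 : s < 1 by rewrite -[ltRHS]sqrtr1 ltr_sqrt.
pose K := (s^-1 - 1)^-1.
have sV1 : 0 < s^-1 - 1 by rewrite subr_gt0 invf_gt1.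
have K0 : 0 < K by rewrite invr_gt0.
have bound n : n%:R * s ^+ n <= K.
  have := @bernoulli_ge (s^-1 - 1) n; rewrite [1 + (_ - 1)]addrC subrK exprVn.
  move=> /(_ _)/wrap[]; first by rewrite (le_trans _ (ltW sV1))// lerN10.
  move=> h; rewrite /K -[leRHS]mul1r ler_pdivlMr// mulrAC.
  have h' : n%:R * (s^-1 - 1) <= (s ^+ n)^-1 by apply: le_trans h; rewrite lerDr.
  rewrite (le_trans (ler_wpM2r _ h'))// ?exprn_ge0 ?(ltW sp)// mulVf//.
  by rewrite expf_neq0// gt_eqF.
apply: (@squeeze_cvgr _ _ _ _ (cst 0) (fun n => K * s ^+ n)).
- apply: nearW => n; rewrite mulr_ge0 ?exprn_ge0//=.
  have -> : r ^+ n = s ^+ n * s ^+ n by rewrite -exprMn -expr2 sqr_sqrtr.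
  by rewrite mulrA ler_wpM2r// exprn_ge0// ltW.
- exact: cvg_cst.
- rewrite -[X in _ --> X](mulr0 K); apply: cvgM; first exact: cvg_cst.
  by apply: cvg_expr; rewrite ger0_norm// ltW.
Qed.

(* With z = (1 - y) / 2 this is (1 - z^n)^(n 2^n), which by Bernoulli lies     *)
(* above 1 - n (2z)^n, and below 1 / (1 + n) as soon as z >= 1/2.              *)
Definition stepn n y : R := (1 - ((1 - y) / 2) ^+ n) ^+ (n * 2 ^ n).

Lemma half_itv y : `|y| <= 1 -> 0 <= (1 - y) / 2 <= 1.
Proof. by rewrite ler_norml => /andP[? ?]; apply/andP; split; lra. Qed.

Lemma stepn_itv n y : `|y| <= 1 -> 0 <= stepn n y <= 1.
Proof.
move=> /half_itv/andP[z0 z1].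
have h : 0 <= 1 - ((1 - y) / 2) ^+ n <= 1.
  by rewrite subr_ge0 exprn_ile1//= lerBlDr lerDl exprn_ge0.
by have /andP[h0 h1] := h; rewrite /stepn exprn_ge0//= exprn_ile1.
Qed.

Lemma cvg_stepn y : `|y| <= 1 -> stepn n y @[n --> \oo] --> ((0 < y)%R%:R : R).
Proof.
move=> y1; have /andP[z0 z1] := half_itv y1.
have nzE n : (n * 2 ^ n)%:R * ((1 - y) / 2) ^+ n = n%:R * (1 - y) ^+ n.
  rewrite natrM natrX expr_div_n -mulrA; congr (_ * _).
  by rewrite mulrC divfK// expf_neq0.
have y01 : 0 <= 1 - y by rewrite subr_ge0; apply: le_trans y1; exact: ler_norm.
have [y0|y0] := ltP 0 y.
  apply: (@squeeze_cvgr _ _ _ _ (fun n => 1 - n%:R * (1 - y) ^+ n) (cst 1)).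
  - apply: nearW => n; have /andP[_ ->] := stepn_itv n y1; rewrite andbT.
    rewrite -nzE -mulrN; apply: bernoulli_ge.
    by rewrite lerN2 exprn_ile1.
  - rewrite -[X in _ --> X]subr0; apply: cvgB; first exact: cvg_cst.
    by apply: cvg_natrM_expr; rewrite y01 ltrBlDr ltrDl.
  - exact: cvg_cst.
apply: (@squeeze_cvgr _ _ _ _ (cst 0) (fun n => n.+1%:R^-1)).
- apply: nearW => n; have /andP[-> s1] := stepn_itv n y1; rewrite /=.
  rewrite -[leRHS]mul1r ler_pdivlMr//.
  have zn0 : 0 <= ((1 - y) / 2) ^+ n by rewrite exprn_ge0.
  (* With [x] the power of [(1 - y) / 2] and [N] the outer exponent, Bernoulli gives
     [(1 + x) ^+ N >= n + 1], while the product of [(1 - x) ^+ N] and [(1 + x) ^+ N] is at most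
     1. *)
  apply: (@le_trans _ _ (stepn n y * (1 + ((1 - y) / 2) ^+ n) ^+ (n * 2 ^ n))).
    rewrite ler_wpM2l//; first by have /andP[] := stepn_itv n y1.
    apply: (le_trans _ (bernoulli_ge _ _)); last by rewrite (le_trans _ zn0)// lerN10.
    rewrite nzE -natr1 addrC lerD2l -[leLHS]mulr1 ler_wpM2l// exprn_ege1//.
    by rewrite lerBrDr gerDl.
  rewrite /stepn -exprMn exprn_ile1//.
    by rewrite mulr_ge0 ?subr_ge0 ?exprn_ile1 ?addr_ge0.
  by rewrite -subr_sqr expr1n lerBlDr lerDl sqr_ge0.
- exact: cvg_cst.
- exact: cvg_harmonic.
Qed.

End real_powers.

(** * The sigma-algebra of sets whose indicator is a multiplier *)

Section multiplier_sets.
Context {R : realType} {d : measure_display} {X : measurableType d}.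
Variables (mu : {measure set X -> \bar R}) (F : set X).
Hypothesis mF : measurable F.
Variables (I : zmodType) (e : I -> X -> R[i]).
Hypothesis me : forall k, cmeasurable (e k).
Hypothesis sqn_e : forall k t, sqn (e k t) = 1.
Hypothesis e0 : forall t, e 0 t = 1.
Hypothesis eD : forall k l t, e (k + l) t = e k t * e l t.
Implicit Types (h g : X -> R[i]) (u v : X -> R).
Local Notation approximable := (approximable mu F e).
Local Notation multiplier := (multiplier mu F e).
Local Notation square_integrable := (square_integrable mu F).

Let mcst (a : R) : multiplier (fun=> a).
Proof. exact: multiplier_cst. Qed.

Definition multiplier_set (A : set X) := measurable A /\ multiplier (\1_A).

Lemma multiplier_setT : multiplier_set setT.
Proof.
split => //; rewrite (_ : \1_setT = fun=> 1); first exact: mcst.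
by apply/funext => t; rewrite indicT.
Qed.

Lemma multiplier_setC A : multiplier_set A -> multiplier_set (~` A).
Proof.
move=> [mA uA]; split; first exact: measurableC.
have := multiplierB mF me sqn_e e0 eD (mcst 1) uA.
congr multiplier; apply/funext => t.
by rewrite !indicE in_setC; case: (t \in A); rewrite /= ?subrr ?subr0.
Qed.

Lemma multiplier_setI A B : multiplier_set A -> multiplier_set B ->
  multiplier_set (A `&` B).
Proof.
move=> [mA uA] [mB uB]; split; first exact: measurableI.
by rewrite indicI; exact: multiplierM.
Qed.

Lemma multiplier_setU A B : multiplier_set A -> multiplier_set B ->
  multiplier_set (A `|` B).
Proof.
move=> mA mB; rewrite -[_ `|` _]setCK setCU.
by apply: multiplier_setC; apply: multiplier_setI; exact: multiplier_setC.
Qed.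

Lemma multiplier_set0 : multiplier_set set0.
Proof. by rewrite -setCT; apply: multiplier_setC; exact: multiplier_setT. Qed.

Lemma multiplier_bigcup (A : nat -> set X) : (forall n, multiplier_set (A n)) ->
  multiplier_set (\bigcup_n A n).
Proof.
move=> mA; have mU : measurable (\bigcup_n A n).
  by apply: bigcup_measurable => n _; have [] := mA n.
split => //; pose U n := \big[setU/set0]_(i < n) A i.
have mUn n : multiplier_set (U n).
  elim: n => [|n IH]; first by rewrite /U big_ord0; exact: multiplier_set0.
  by rewrite /U big_ord_recr /=; exact: multiplier_setU.
apply: (multiplier_lim mF me (un := fun n => \1_(U n)) (C := 1)).
- exact: measurable_indic.
- by move=> n; have [] := mUn n.
- by move=> n t; rewrite ger0_norm ?indicE// lern1 leq_b1.
- move=> t; have [[i _ Ait]|nA] := pselect ((\bigcup_n A n) t).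
    apply: cvg_near_cst; exists i.+1 => // n /= ni.
    rewrite !indicE !mem_set//; first by exists i.
    by rewrite /U -bigcup_mkord; exists i.
  apply: cvg_near_cst; apply: nearW => n.
  rewrite !indicE !memNset// /U -bigcup_mkord => -[i _ Ait].
  by apply: nA; exists i.
Qed.

(** Each [stepn n] is a polynomial, so its composition with [u] is again a multiplier; these
    compositions lie in [0, 1] and converge pointwise to the indicator. *)
Lemma multiplier_set_gt0 u : multiplier u -> (forall t, `|u t| <= 1) ->
  multiplier_set [set t | 0 < u t].
Proof.
move=> mu_ u1; have [mfu _ _] := mu_.
have mA : measurable [set t | 0 < u t].
  rewrite [X in measurable X](_ : _ = u @^-1` `]0, +oo[%classic).
    by rewrite -[X in measurable X]setTI; exact: mfu.
  by apply/seteqP; split=> t /=; rewrite in_itv/= andbT.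
split; first exact: mA.
apply: (multiplier_lim mF me (un := fun n t => stepn n (u t)) (C := 1)).
- exact: measurable_indic.
- move=> n; apply: (multiplierX mF me sqn_e e0 eD).
  apply: (multiplierB mF me sqn_e e0 eD (mcst 1)).
  apply: (multiplierX mF me sqn_e e0 eD); apply: (multiplierM mF _ (mcst 2^-1)).
  exact: (multiplierB mF me sqn_e e0 eD (mcst 1)).
- by move=> n t; have /andP[s0 s1] := stepn_itv n (u1 t); rewrite ger0_norm.
- move=> t; rewrite indicE (_ : (t \in _) = (0 < u t)); first exact: cvg_stepn.
  by apply/idP/idP => [/set_mem//|h]; exact/mem_set.
Qed.

Lemma sigma_algebra_multiplier_set : sigma_algebra setT multiplier_set.
Proof.
split; first exact: multiplier_set0.
  by move=> A mA; rewrite setTD; exact: multiplier_setC.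
exact: multiplier_bigcup.
Qed.

End multiplier_sets.

(** * From indicators to all square integrable functions *)

Section density_from_indicators.
Context {R : realType} {d : measure_display} {X : measurableType d}.
Variables (mu : {measure set X -> \bar R}) (F : set X).
Hypothesis mF : measurable F.
Variables (I : zmodType) (e : I -> X -> R[i]).
Hypothesis me : forall k, cmeasurable (e k).
Hypothesis sqn_e : forall k t, sqn (e k t) = 1.
Hypothesis e0 : forall t, e 0 t = 1.
Hypothesis eD : forall k l t, e (k + l) t = e k t * e l t.
Implicit Types (h g : X -> R[i]) (u v : X -> R).
Local Notation approximable := (approximable mu F e).
Local Notation square_integrable := (square_integrable mu F).
Hypothesis approximable_indic : forall A, measurable A ->
  approximable (fun t => Complex (\1_A t) 0).

Import HBNNSimple.

Let approximable_nnsfun (f : {nnsfun X >-> R}) :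
  approximable (fun t => Complex (f t) 0).
Proof.
pose s := finmap.enum_fset (fset_set (range f)).
have fE t : Complex (f t) 0 = \sum_(y <- s)
    Complex y 0 * Complex (\1_(f @^-1` [set y]) t) 0 :> R[i].
  rewrite fimfunE fsbig_finite//=.
  elim/big_ind2: _ => // [x1 x2 y1 y2 <- <-|y _]; by rewrite ?complex_realD ?complex_realM.
rewrite (_ : (fun t => _) = fun t => \sum_(y <- s)
    Complex y 0 * Complex (\1_(f @^-1` [set y]) t) 0 :> R[i]); last exact/funext.
have mi y : cmeasurable (fun t => Complex y 0 * Complex (\1_(f @^-1` [set y]) t) 0 : R[i]).
  by apply: cmeasurableM; apply: cmeasurable_real.
elim: s {fE} => [|y s IH].
  under eq_fun do rewrite big_nil.
  have := approximable_indic measurable0.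
  by congr approximable; apply/funext => t; rewrite indic0.
under eq_fun do rewrite big_cons.
apply: approximableD => //; first exact: cmeasurable_sum.
apply: (approximableZ mF me sqn_e e0 eD); first exact: cmeasurable_real.
exact: approximable_indic.
Qed.

Let approximable_ge0 u : measurable_fun setT u -> (forall t, 0 <= u t) ->
  square_integrable (fun t => Complex (u t) 0) ->
  approximable (fun t => Complex (u t) 0).
Proof.
move=> mu_ u0 [mc u2].
have mE : measurable_fun setT (EFin \o u) by exact/measurable_EFinP.
pose un := nnsfun_approx measurableT mE.
have cv t : un n t @[n --> \oo] --> u t.
  have /(_ t Logic.I)/fine_cvgP[_] :=
    @cvg_nnsfun_approx _ _ _ _ measurableT _ mE (fun t _ => u0 t).
  exact.
have un_le n t : un n t <= u t.
  have nd : nondecreasing_seq (fun n => un n t).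
    by move=> i j ij; exact/lefP/nd_nnsfun_approx.
  rewrite -(cvg_lim (@Rhausdorff R) (cv t)); apply: nondecreasing_cvgn_le => //.
  by apply/cvg_ex; exists (u t).
have E n t : sqn (Complex (u t) 0 - Complex (un n t) 0) = (u t - un n t) ^+ 2.
  have -> : - Complex (un n t) 0 = Complex (- un n t) 0 :> R[i].
    by apply/eqP; rewrite eq_complex ReN ImN /= oppr0 !eqxx.
  by rewrite complex_realD sqn_real.
apply: (@approximable_dominated _ _ _ mu F mF _ _ me _ (fun n t => Complex (un n t) 0)
  (fun t => u t ^+ 2)) => //.
- move=> t; under eq_fun do rewrite E.
  have -> : 0 = (u t - u t) ^+ 2 by rewrite subrr expr0n.
  apply: (cvg_comp (fun n => u t - un n t) (fun x => x ^+ 2)).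
    by apply: cvgB; [exact: cvg_cst|exact: cv].
  exact: exprn_continuous.
- apply/integrableP; split.
    by apply/measurable_EFinP; apply: measurable_funTS; exact: measurable_funX.
  rewrite (eq_integral (fun t => (sqn (Complex (u t) 0))%:E))// => t _.
  by rewrite sqn_real /= ger0_norm ?sqr_ge0.
- move=> n t; rewrite E lerXn2r ?nnegrE ?subr_ge0//.
  by rewrite lerBlDr lerDl fun_ge0.
Qed.

Let approximable_real u : measurable_fun setT u ->
  square_integrable (fun t => Complex (u t) 0) ->
  approximable (fun t => Complex (u t) 0).
Proof.
move=> mu_ [mc u2].
have dom (v : X -> R) : measurable_fun setT v -> (forall t, `|v t| <= `|u t|) ->
    square_integrable (fun t => Complex (v t) 0).
  move=> mv vu; have mcv := cmeasurable_real mv; split => //.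
  apply: le_lt_trans u2; apply: ge0_le_integral => //.
  - by move=> t _; rewrite lee_fin sqn_ge0.
  - exact: measurable_sqnE.
  - exact: measurable_sqnE.
  - move=> t _; rewrite !sqn_real lee_fin -(real_normK (num_real (v t))).
    by rewrite -(real_normK (num_real (u t))) lerXn2r ?nnegrE.
have -> : (fun t => Complex (u t) 0) =
    (fun t => Complex (Num.max (u t) 0) 0 +
              Complex (-1) 0 * Complex (Num.max (- u t) 0) 0) :> (X -> R[i]).
  apply/funext => t; rewrite complex_realM complex_realD; congr Complex.
  by case: (ltrgt0P (u t)) => ut; rewrite ?maxEle; case: ifP; lra.
have m1 : measurable_fun setT (fun t => Num.max (u t) 0) by exact: measurable_maxr.
have m2 : measurable_fun setT (fun t => Num.max (- u t) 0).
  by apply: measurable_maxr => //; exact: measurable_funN.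
apply: approximableD => //.
- by apply: cmeasurableM; [exact: cmeasurable_cst|exact: cmeasurable_real].
- apply: approximable_ge0 => //; first by move=> t; rewrite le_max lexx orbT.
  apply: dom => // t; rewrite ger0_norm ?le_max ?lexx ?orbT// ge_max normr_ge0 andbT.
  exact: ler_norm.
- apply: (approximableZ mF me sqn_e e0 eD); first exact: cmeasurable_real.
  apply: approximable_ge0 => //; first by move=> t; rewrite le_max lexx orbT.
  apply: dom => // t; rewrite ger0_norm ?le_max ?lexx ?orbT// ge_max normr_ge0 andbT.
  by rewrite -normrN ler_norm.
Qed.

Lemma approximable_square_integrable h : square_integrable h -> approximable h.
Proof.
move=> [[m1 m2] h2]; have mh : cmeasurable h by [].
have dom (v : X -> R) : measurable_fun setT v -> (forall t, v t ^+ 2 <= sqn (h t)) ->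
    square_integrable (fun t => Complex (v t) 0).
  move=> mv vu; have mcv := cmeasurable_real mv; split => //.
  apply: le_lt_trans h2; apply: ge0_le_integral => //.
  - by move=> t _; rewrite lee_fin sqn_ge0.
  - exact: measurable_sqnE.
  - exact: measurable_sqnE.
  - by move=> t _; rewrite !sqn_real lee_fin.
have -> : h = (fun t => Complex (complex.Re (h t)) 0 +
                        Complex 0 1 * Complex (complex.Im (h t)) 0).
  apply/funext => t; apply/eqP; rewrite eq_complex ReD ImD ReM ImM /=.
  by rewrite !(mul0r, mulr0, mul1r, subr0, addr0, add0r) !eqxx.
apply: approximableD => //.
- by apply: cmeasurableM; [exact: cmeasurable_cst|exact: cmeasurable_real].
- by apply: approximable_real => //; apply: dom => // t; rewrite lerDl sqr_ge0.
- apply: (approximableZ mF me sqn_e e0 eD); first exact: cmeasurable_real.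
  by apply: approximable_real => //; apply: dom => // t; rewrite lerDr sqr_ge0.
Qed.

End density_from_indicators.

(** * Parseval's identity *)

Section parseval.
Context {R : realType} {d : measure_display} {X : measurableType d}.
Variables (mu : {measure set X -> \bar R}) (F : set X).
Hypothesis mF : measurable F.
Variables (I : choiceType) (e : I -> X -> R[i]) (c : R).
Hypothesis c_gt0 : 0 < c.
Hypothesis muF : mu F = c%:E.
Hypothesis me : forall k, cmeasurable (e k).
Hypothesis sqn_e : forall k t, sqn (e k t) = 1.
Implicit Types (h g : X -> R[i]).
Local Notation square_integrable := (square_integrable mu F).

Definition cint h : R[i] := Complex (\int[mu]_(t in F) complex.Re (h t))
                                    (\int[mu]_(t in F) complex.Im (h t)).

(** Not normalized: each [e k] has squared norm [c], so the projection of [h] onto it has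
    coefficient [coef h k] divided by [c]. *)
Definition coef h k := cint (fun t => h t * conjc (e k t)).

Hypothesis e_orthogonal : forall k l, k != l -> coef (e k) l = 0.

Definition cintegrable h := mu.-integrable F (fun t => (complex.Re (h t))%:E) /\
  mu.-integrable F (fun t => (complex.Im (h t))%:E).

Lemma cintD h g : cintegrable h -> cintegrable g ->
  cint (fun t => h t + g t) = cint h + cint g.
Proof.
move=> [h1 h2] [g1 g2]; apply/eqP; rewrite eq_complex ReD ImD /=; apply/andP; split.
  by under eq_Rintegral do rewrite ReD; rewrite RintegralD.
by under eq_Rintegral do rewrite ImD; rewrite RintegralD.
Qed.

Lemma cintegrableZ (z : R[i]) h : cintegrable h -> cintegrable (fun t => z * h t).
Proof.
move=> [h1 h2]; split.
  under eq_fun do rewrite ReM EFinB !EFinM.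
  by apply: integrableB => //; exact: integrableZl.
under eq_fun do rewrite ImM EFinD !EFinM.
by apply: integrableD => //; exact: integrableZl.
Qed.

Lemma cintZ (z : R[i]) h : cintegrable h -> cint (fun t => z * h t) = z * cint h.
Proof.
move=> [h1 h2]; apply/eqP; rewrite eq_complex ReM ImM /=; apply/andP; split.
  under eq_Rintegral do rewrite ReM.
  rewrite RintegralB//; first by rewrite !RintegralZl.
    exact: (integrableZl mF (complex.Re z) h1).
  exact: (integrableZl mF (complex.Im z) h2).
under eq_Rintegral do rewrite ImM.
rewrite RintegralD//; first by rewrite !RintegralZl.
  exact: (integrableZl mF (complex.Re z) h2).
exact: (integrableZl mF (complex.Im z) h1).
Qed.

Lemma integrable_cst1 : mu.-integrable F (fun=> 1%E).
Proof.
apply/integrableP; split; first exact: measurable_cst.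
by under eq_integral do rewrite abse1; rewrite integral_cst// mul1e muF ltry.
Qed.

Lemma integrable_sqn h : square_integrable h ->
  mu.-integrable F (fun t => (sqn (h t))%:E).
Proof.
move=> [mh h2]; apply/integrableP; split; first exact: measurable_sqnE.
by under eq_integral do rewrite gee0_abs ?lee_fin ?sqn_ge0//.
Qed.

(** [F] has finite measure, and the absolute value of [x] is at most [1 + x ^+ 2]. *)
Lemma square_integrable_cintegrable h : square_integrable h -> cintegrable h.
Proof.
move=> h2; have [[m1 m2] _] := h2.
have i1 : mu.-integrable F (fun t => 1 + (sqn (h t))%:E)%E.
  by apply: integrableD => //; [exact: integrable_cst1|exact: integrable_sqn].
have x1 (x : R) : `|x| <= 1 + x ^+ 2.
  have := sqr_ge0 (`|x| - 1); rewrite -[x ^+ 2]real_normK ?num_real//; nra.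
split; apply: le_integrable i1 => //.
- by apply/measurable_EFinP; exact: measurable_funTS.
- move=> t _; rewrite -EFinD lee_fin (le_trans (x1 _))//.
  by rewrite (ger0_norm (addr_ge0 ler01 (sqn_ge0 _))) lerD2l /sqn lerDl sqr_ge0.
- by apply/measurable_EFinP; exact: measurable_funTS.
- move=> t _; rewrite -EFinD lee_fin (le_trans (x1 _))//.
  by rewrite (ger0_norm (addr_ge0 ler01 (sqn_ge0 _))) lerD2l /sqn lerDr sqr_ge0.
Qed.

Lemma square_integrableMe h k : square_integrable h ->
  square_integrable (fun t => h t * conjc (e k t)).
Proof.
move=> [mh h2]; split; first by apply: cmeasurableM => //; exact: cmeasurable_conjc.
by under eq_integral do rewrite sqnM sqn_conjc sqn_e mulr1.
Qed.

Lemma square_integrable_e k : square_integrable (e k).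
Proof.
split => //; under eq_integral do rewrite sqn_e.
by rewrite integral_cst// mul1e muF ltry.
Qed.

Lemma square_integrableB h (z : R[i]) k : square_integrable h ->
  square_integrable (fun t => h t - z * e k t).
Proof.
move=> h2; have [mh _] := h2.
have mz : cmeasurable (fun t => z * e k t).
  by apply: cmeasurableM => //; exact: cmeasurable_cst.
split; first exact: cmeasurableB.
have : mu.-integrable F (fun t => 2%:E * (sqn (h t))%:E + (2 * sqn z)%:E * 1)%E.
  apply: integrableD => //; apply: integrableZl => //; first exact: integrable_sqn.
  exact: integrable_cst1.
move=> /integrableP[_]; apply: le_lt_trans; apply: ge0_le_integral => //.
- by move=> t _; rewrite lee_fin sqn_ge0.
- by apply: measurable_sqnE; exact: cmeasurableB.
- apply: measurableT_comp => //; apply: emeasurable_funD => //.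
  by apply: emeasurable_funM => //; exact: measurable_sqnE.
- move=> t _; rewrite mule1 -EFinM -EFinD lee_fin.
  apply: le_trans (ler_norm _); rewrite (le_trans (sqnD_le _ _))//.
  by rewrite sqnN sqnM sqn_e mulr1.
Qed.

Definition energy h : R := \int[mu]_(t in F) sqn (h t).

Lemma energyB h (z : R[i]) k : square_integrable h ->
  energy (fun t => h t - z * e k t) =
  energy h + (c * sqn z - 2 * complex.Re (conjc z * coef h k)).
Proof.
move=> h2.
have ih := integrable_sqn h2.
have [i1 i2] := square_integrable_cintegrable (square_integrableMe k h2).
have [j1 _] := cintegrableZ (conjc z) (conj i1 i2).
have E t : sqn (h t - z * e k t) = sqn (h t) +
    (sqn z * 1 - 2 * complex.Re (conjc z * (h t * conjc (e k t)))).
  (* Reading the factor 1 next to [sqn z] as [sqn (e k t)] leaves a polynomial identity in real and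
     imaginary parts. *)
  rewrite -{1}(sqn_e k t); case: (h t) (e k t) => a b [x y]; case: (z) => p q.
  rewrite /sqn /=; ring.
rewrite /energy; under eq_Rintegral do rewrite E.
have iz : mu.-integrable F (EFin \o (fun=> sqn z * 1)).
  have := integrableZl mF (sqn z) integrable_cst1.
  by apply: eq_integrable => // t _ /=; rewrite EFinM.
have i2j : mu.-integrable F
    (EFin \o (fun t => 2 * complex.Re (conjc z * (h t * conjc (e k t))))).
  have := integrableZl mF 2 j1.
  by apply: eq_integrable => // t _ /=; rewrite EFinM.
rewrite RintegralD//; last exact: (integrableB mF iz i2j).
rewrite RintegralB//.
have -> : \int[mu]_(_ in F) (sqn z * 1) = c * sqn z.
  by rewrite Rintegral_cst// muF /= mulr1 mulrC.
by rewrite RintegralZl// /coef -cintZ.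
Qed.

Lemma coefB h (z : R[i]) k l : square_integrable h -> k != l ->
  coef (fun t => h t - z * e k t) l = coef h l.
Proof.
move=> h2 kl; rewrite -[RHS]addr0 -(mulr0 (- z)) -(e_orthogonal kl) -cintZ; last first.
  by apply: square_integrable_cintegrable; apply: square_integrableMe; exact: square_integrable_e.
rewrite -cintD; last 2 first.
- by apply: square_integrable_cintegrable; exact: square_integrableMe.
- apply: cintegrableZ; apply: square_integrable_cintegrable.
  by apply: square_integrableMe; exact: square_integrable_e.
by congr cint; apply/funext => t; rewrite mulrBl mulNr mulrA.
Qed.

(** Frequencies are removed one at a time: by orthogonality ([coefB]), removing one leaves the
    coefficients at the others unchanged. *)
Lemma energyB_sum h (z : I -> R[i]) (J : seq I) : uniq J -> square_integrable h ->
  energy (fun t => h t - \sum_(k <- J) z k * e k t) =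
  energy h + \sum_(k <- J) (c * sqn (z k) - 2 * complex.Re (conjc (z k) * coef h k)).
Proof.
elim: J h => [|k J IH] h.
  by move=> _ _; rewrite big_nil addr0; congr energy; apply/funext => t; rewrite big_nil subr0.
move=> /= /andP[kJ uJ] h2; rewrite big_cons addrA -energyB//.
have -> : (fun t => h t - \sum_(l <- k :: J) z l * e l t) =
    (fun t => (h t - z k * e k t) - \sum_(l <- J) z l * e l t).
  by apply/funext => t; rewrite big_cons opprD addrA.
rewrite IH//; last exact: square_integrableB.
congr (_ + _); rewrite !big_seq; apply: eq_bigr => l lJ.
rewrite coefB//; apply: contraNneq kJ => ->//.
Qed.

Lemma energy_ge0 h : 0 <= energy h.
Proof. by apply: Rintegral_ge0 => t _; exact: sqn_ge0. Qed.

Lemma bessel h (J : seq I) : uniq J -> square_integrable h ->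
  \sum_(k <- J) sqn (coef h k) <= c * energy h.
Proof.
move=> uJ h2.
have := energy_ge0 (fun t => h t - \sum_(k <- J) (Complex c^-1 0 * coef h k) * e k t).
rewrite energyB_sum// (eq_bigr (fun k => - (c^-1 * sqn (coef h k)))); last first.
  move=> k _; rewrite sqnM sqn_real; case: (coef h k) => a b; rewrite /sqn /=.
  by field; rewrite gt_eqF.
rewrite sumrN -mulr_sumr subr_ge0 mulrC ler_pdivrMr// mulrC//.
Qed.

(** Completing the square: at each frequency the defect is [sqn (coef h k - c * z k)], with [c] read
    as a complex number. Thus any good approximation, whatever its coefficients, forces the sum of
    squared coefficients to be nearly maximal. *)
Lemma bessel_lower h (z : I -> R[i]) (J : seq I) : uniq J -> square_integrable h ->
  c * energy h - c * energy (fun t => h t - \sum_(k <- J) z k * e k t) <=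
  \sum_(k <- J) sqn (coef h k).
Proof.
move=> uJ h2; rewrite energyB_sum// -mulrBr opprD addrA subrr add0r mulrN -mulNr.
rewrite mulr_sumr; apply: ler_sum => k _; rewrite -subr_ge0.
have -> : sqn (coef h k) - - c * (c * sqn (z k) - 2 * complex.Re (conjc (z k) * coef h k)) =
    sqn (coef h k - Complex c 0 * z k).
  by case: (coef h k) => a b; case: (z k) => x y; rewrite /sqn /=; ring.
exact: sqn_ge0.
Qed.

End parseval.

Section parseval_sum.
Context {R : realType} {d : measure_display} {X : measurableType d}.
Variables (mu : {measure set X -> \bar R}) (F : set X).
Hypothesis mF : measurable F.
Variables (I : zmodType) (e : I -> X -> R[i]) (c : R).
Hypothesis c_gt0 : 0 < c.
Hypothesis muF : mu F = c%:E.
Hypothesis me : forall k, cmeasurable (e k).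
Hypothesis sqn_e : forall k t, sqn (e k t) = 1.
Hypothesis e_orthogonal : forall k l, k != l -> coef mu F e (e k) l = 0.

Lemma approximable_ext (h g : X -> R[i]) : (forall t, F t -> h t = g t) ->
  approximable mu F e h -> approximable mu F e g.
Proof.
move=> hg ah eps /ah[s hs]; exists s; apply: le_trans hs.
by rewrite le_eqVlt; apply/orP; left; apply/eqP; apply: eq_integral => t /set_mem/hg ->.
Qed.

(** Collects equal frequencies, since the energy expansion requires distinct ones. *)
Let tpoly_uniq (s : seq (I * R[i])) : exists2 J, uniq J & exists z : I -> R[i],
  forall t, tpoly e s t = \sum_(k <- J) z k * e k t.
Proof.
exists (undup [seq x.1 | x <- s]); first exact: undup_uniq.
exists (fun k => \sum_(x <- s | x.1 == k) x.2) => t.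
under [RHS]eq_bigr do rewrite mulr_suml big_mkcond.
rewrite exchange_big/= /tpoly !big_seq; apply: eq_bigr => x xs.
rewrite -big_mkcond/= (eq_bigl (fun k => k == x.1)); last by move=> k; rewrite eq_sym.
by rewrite -big_filter filter_pred1_uniq ?undup_uniq ?big_seq1// mem_undup map_f.
Qed.

(** Bessel bounds every finite partial sum from above. For the lower bound, approximate [h] within
    [eps / c]; [bessel_lower] multiplies this error by [c]. *)
Lemma parseval (h : X -> R[i]) : square_integrable mu F h -> approximable mu F e h ->
  (\esum_(k in [set: I]) (sqn (coef mu F e h k))%:E = (c * energy mu F h)%:E)%E.
Proof.
move=> h2 ah; apply/eqP; rewrite eq_le; apply/andP; split.
  apply: ge_ereal_sup => _ [J [finJ _] <-]; rewrite fsbig_finite//= sumEFin lee_fin.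
  by apply: bessel => //; exact: finmap.fset_uniq.
apply/lee_addgt0Pr => eps eps0; have ec : 0 < eps / c by rewrite divr_gt0.
have [s hs] := ah _ ec; have [J uJ [z sE]] := tpoly_uniq s.
rewrite -leeBlDr//; apply: esum_ge; exists [set` J]; first by split => //; exact: finite_seq.
rewrite -fsbig_seq// sumEFin -EFinB lee_fin.
apply: le_trans (bessel_lower mF muF me sqn_e e_orthogonal z uJ h2).
rewrite lerB// -ler_pdivlMl// mulrC -lee_fin; apply: (le_trans _ hs).
rewrite /energy /Rintegral fineK.
  rewrite le_eqVlt; apply/orP; left; apply/eqP; apply: eq_integral => t _.
  by rewrite sE.
rewrite ge0_fin_numE; last by apply: integral_ge0 => t _; rewrite lee_fin sqn_ge0.
apply: le_lt_trans (ltry (eps / c)); apply: le_trans hs.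
rewrite le_eqVlt; apply/orP; left; apply/eqP; apply: eq_integral => t _.
by rewrite sE.
Qed.

End parseval_sum.

Section exponentials.
Variable R : realType.
Implicit Types x y : R.

Lemma sqn_expi x : sqn (expi x) = 1.
Proof. exact: cos2Dsin2. Qed.

Lemma expi0 : expi (0 : R) = 1.
Proof. by rewrite /expi cos0 sin0. Qed.

Lemma expiD x y : expi (x + y) = expi x * expi y.
Proof.
apply/eqP; rewrite eq_complex ReM ImM /expi /= cosD sinD.
by rewrite [sin x * cos y + _]addrC [sin x * cos y]mulrC !eqxx.
Qed.

Lemma expiN x : expi (- x) = conjc (expi x).
Proof. by rewrite /expi cosN sinN. Qed.

End exponentials.

(** * Parseval for the characters of a lattice, with frequencies in its dual lattice *)

Section lattice_parseval.
Context {R : realType} {d : nat}.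
Local Notation V := 'cV[R]_d.
Local Notation mu := (lebesgue_cV R d).
Variables M B : 'M[R]_d.
Hypothesis BM : B^T *m M = 1%:M.
Implicit Types (k l : 'cV[int]_d) (t : V).

Let uM : M \in unitmx.
Proof. by have /mulmx1_unit[] := BM. Qed.

Let uB : B \in unitmx.
Proof. by have /mulmx1_unit[] := BM; rewrite unitmx_tr. Qed.

Let BtE : B^T = invmx M.
Proof. by rewrite -[LHS]mulmx1 -(mulmxV uM) mulmxA BM mul1mx. Qed.

Definition expl k t : R[i] := expi (2 * pi * dotv (latv B k) t).

Lemma latv_eq0 k : (latv B k == 0) = (k == 0).
Proof.
apply/eqP/eqP => [|->]; last by rewrite latv0.
move=> /(congr1 (mulmx (invmx B))); rewrite /latv mulKmx// mulmx0 => k0.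
apply/colP => i; move: k0 => /colP/(_ i); rewrite !mxE => /eqP.
by rewrite intr_eq0 => /eqP.
Qed.

Lemma dual_latv k : dual_vector M (latv B k).
Proof.
move=> l; exists ((k^T *m l) ord0 ord0).
rewrite dotvE /latv trmx_mul -mulmxA (mulmxA B^T) BM mul1mx !mxE.
by rewrite rmorph_sum/=; apply: eq_bigr => i _; rewrite !mxE rmorphM.
Qed.

Lemma cmeasurable_expl k : cmeasurable (expl k).
Proof. by split; [exact: measurable_cos_dotv|exact: measurable_sin_dotv]. Qed.

Let sqn_expl k t : sqn (expl k t) = 1. Proof. exact: sqn_expi. Qed.

Let expl0 t : expl 0 t = 1.
Proof.
rewrite /expl latv0 (_ : dotv 0 t = 0) ?mulr0 ?expi0//.
by rewrite /dotv big1// => i _; rewrite mxE mul0r.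
Qed.

Let explD k l t : expl (k + l) t = expl k t * expl l t.
Proof. by rewrite /expl latvD dotvDl mulrDr expiD. Qed.

Variable F : set V.
Hypothesis mF : measurable F.
Hypothesis tileF : forall t, exists k0, forall k, F (t - latv M k) <-> k = k0.

Let weightF : weight M \1_F.
Proof.
split => //.
by apply: aeW => t; have [k0 /lsum_indic_unique] := tileF t.
Qed.

Let detM_gt0 : 0 < `|\det M|.
Proof. by rewrite normr_gt0 -unitfE -unitmxE. Qed.

Let muF : mu F = `|\det M|%:E.
Proof. by rewrite -(integral_weight uM weightF) integral_indic// setIT. Qed.

Let Rintegral_indic (f : V -> R) : \int[mu]_(t in F) f t = \int[mu]_t (f t * \1_F t).
Proof.
rewrite Rintegral_mkcond; apply: eq_Rintegral => t _.
by rewrite patchE indicE; case: ifP => _; rewrite ?mulr1 ?mulr0.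
Qed.

Let expl_orthogonal k l : k != l -> coef mu F expl (expl k) l = 0.
Proof.
move=> kl; rewrite /coef /cint.
have E t : expl k t * conjc (expl l t) = expi (2 * pi * dotv (latv B (k - l)) t).
  by rewrite /expl -expiN -expiD -mulrN -mulrDr -dotvNl -dotvDl latvB.
have v0 : latv B (k - l) != 0 by rewrite latv_eq0 subr_eq0.
under eq_Rintegral do rewrite E.
under [X in Complex _ X]eq_Rintegral do rewrite E.
have dv := dual_latv (k - l).
by rewrite !Rintegral_indic (Rintegral_cos_weight uM v0 dv weightF)
  (Rintegral_sin_weight uM v0 dv weightF).
Qed.

Local Notation multiplier := (multiplier mu F expl).
Local Notation multiplier_set := (multiplier_set mu F expl).

Let mcst (a : R) : multiplier (fun=> a).
Proof. by apply: multiplier_cst => //; exact: cmeasurable_expl. Qed.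

(** The shape shared by Euler's formulas for cosine and sine, which the multiplier lemmas below
    use. *)
Let approximable_lin (z1 z2 : R[i]) k (h : V -> R[i]) : cmeasurable h ->
  approximable mu F expl h ->
  approximable mu F expl (fun t => z1 * expl k t * h t + z2 * expl (- k) t * h t).
Proof.
move=> mh ah.
have m z l : cmeasurable (fun t => z * expl l t * h t).
  apply: cmeasurableM => //; apply: cmeasurableM; first exact: cmeasurable_cst.
  exact: cmeasurable_expl.
apply: approximableD => //; first exact: cmeasurable_expl.
  by apply: approximableMe => //; exact: cmeasurable_expl.
by apply: approximableMe => //; exact: cmeasurable_expl.
Qed.

Let explN k t : expl (- k) t = conjc (expl k t).
Proof. by rewrite /expl latvN dotvNl mulrN expiN. Qed.

Let multiplier_cos k : multiplier (fun t => cos (2 * pi * dotv (latv B k) t)).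
Proof.
split; first exact: measurable_cos_dotv.
  by exists 1 => t; exact: norm_cos_le1.
move=> h [mh _] ah.
have := approximable_lin (Complex 2^-1 0) (Complex 2^-1 0) k mh ah.
apply: approximable_ext => t _; rewrite explN -mulrDl; congr (_ * _).
apply/eqP; rewrite eq_complex ReD ImD !ReM !ImM /expl /=; apply/andP; split; apply/eqP; lra.
Qed.

Let multiplier_sin k : multiplier (fun t => sin (2 * pi * dotv (latv B k) t)).
Proof.
split; first exact: measurable_sin_dotv.
  by exists 1 => t; exact: norm_sin_le1.
move=> h [mh _] ah.
have := approximable_lin (Complex 0 (- 2^-1)) (Complex 0 2^-1) k mh ah.
apply: approximable_ext => t _; rewrite explN -mulrDl; congr (_ * _).
apply/eqP; rewrite eq_complex ReD ImD !ReM !ImM /expl /=; apply/andP; split; apply/eqP; lra.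
Qed.

(** The fractional parts of the coordinates in the basis [M]. Periodic sets are exactly preimages
    under this map, since [M *m fracv t] differs from [t] by a lattice vector. *)
Let fracv t : V := \col_i ((invmx M *m t) i ord0 - (Num.floor ((invmx M *m t) i ord0))%:~R).

Let fracv_itv t i : 0 <= fracv t i ord0 < 1.
Proof.
rewrite [fracv t i ord0]mxE subr_ge0 floor_le/= ltrBlDr addrC.
by have /andP[_] := floor_itv ((invmx M *m t) i ord0); rewrite intrD.
Qed.

Let dotv_delta i t : dotv (latv B (delta_mx i ord0)) t = (invmx M *m t) i ord0.
Proof.
rewrite dotvE /latv trmx_mul BtE map_delta_mx trmx_delta -mulmxA -rowE mxE.
by [].
Qed.

(* A product of sines that is a trigonometric polynomial (by [psiE]) and is    *)
(* positive exactly when the fractional coordinate lies strictly in (0, a).    *)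
Let psi (a : R) i t : R := sin (pi * fracv t i ord0) * sin (pi * (a - fracv t i ord0)).

(** Product-to-sum formula: the sum of the two angles is the constant [pi * a], and in their
    difference the integer part contributes a multiple of [2 * pi], which the cosine ignores. *)
Let psiE a i t : psi a i t =
  (cos (2 * pi * dotv (latv B (delta_mx i ord0)) t) * cos (pi * a) +
   sin (2 * pi * dotv (latv B (delta_mx i ord0)) t) * sin (pi * a) - cos (pi * a)) * 2^-1.
Proof.
rewrite -cosB dotv_delta.
have -> : cos (2 * pi * (invmx M *m t) i ord0 - pi * a) =
    cos (pi * fracv t i ord0 - pi * (a - fracv t i ord0)).
  rewrite -[RHS](cosD2piz _ (Num.floor ((invmx M *m t) i ord0))).
  by congr cos; rewrite [fracv t i ord0]mxE; ring.
have -> : cos (pi * a) = cos (pi * fracv t i ord0 + pi * (a - fracv t i ord0)).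
  by congr cos; ring.
by rewrite cosB cosD /psi; field.
Qed.

Let psi_norm a i t : `|psi a i t| <= 1.
Proof. by rewrite normrM mulr_ile1// norm_sin_le1. Qed.

Let multiplier_psi a i : multiplier (psi a i).
Proof.
have me := cmeasurable_expl.
rewrite (funext (psiE a i)).
have m1 := multiplierM mF (multiplier_cos (delta_mx i ord0)) (mcst (cos (pi * a))).
have m2 := multiplierM mF (multiplier_sin (delta_mx i ord0)) (mcst (sin (pi * a))).
have m3 := multiplierB mF me sqn_expl expl0 explD (multiplierD mF me m1 m2)
  (mcst (cos (pi * a))).
exact: (multiplierM mF m3 (mcst 2^-1)).
Qed.

Let psi_gt0 a i t : 0 < a <= 1 -> (0 < psi a i t) = (0 < fracv t i ord0 < a).
Proof.
move=> /andP[a0 a1]; have /andP[] := fracv_itv t i; rewrite /psi.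
move: (fracv t i ord0) => r r0 r1; have pi0 := pi_gt0 R.
have [->|rn0] := eqVneq r 0; first by rewrite mulr0 sin0 mul0r ltxx.
have rp : 0 < r by rewrite lt_def rn0.
rewrite rp pmulr_rgt0; last by rewrite sin_gt0_pi// mulr_gt0//= gtr_pMr.
have [ra|ra] := ltP r a.
  by rewrite sin_gt0_pi// mulr_gt0 ?subr_gt0//= gtr_pMr// ltrBlDr (le_lt_trans a1)// ltrDl.
apply/negbTE; rewrite -leNgt -oppr_ge0 -sinN -mulrN opprB sin_ge0_pi//.
rewrite mulr_ge0 ?subr_ge0 ?(ltW pi0)//= ger_pMr// lerBlDr (le_trans (ltW r1))// lerDl ltW//.
Qed.

Let multiplier_fracv_lt a i : multiplier_set [set t | fracv t i ord0 < a].
Proof.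
have me := cmeasurable_expl.
have gt0 b : multiplier_set [set t | 0 < psi b i t].
  by apply: multiplier_set_gt0 => //; exact: multiplier_psi.
have [a0|a0] := leP a 0.
  rewrite (_ : [set t | _] = set0); first exact: multiplier_set0.
  rewrite -subset0 => t /= /lt_le_trans/(_ a0); have /andP[+ _] := fracv_itv t i.
  by move=> /le_lt_trans /[apply]; rewrite ltxx.
have [a1|a1] := ltP 1 a.
  rewrite (_ : [set t | _] = setT); first exact: multiplier_setT.
  rewrite -subTset => t _ /=; have /andP[_ +] := fracv_itv t i.
  by move=> /lt_trans; apply.
(* Positivity of [psi a] misses the points whose fractional coordinate is 0; these form the
   complement of the positivity set of [psi 1]. *)
rewrite (_ : [set t | _] = [set t | 0 < psi a i t] `|` ~` [set t | 0 < psi 1 i t]).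
  by apply: multiplier_setU => //; exact: multiplier_setC.
apply/seteqP; split => t /=; rewrite !psi_gt0 ?a0 ?a1 ?ltr01 ?lexx//;
  have /andP[f0 f1] := fracv_itv t i.
  move=> fa; rewrite fa andbT f1 andbT; have [->|fn0] := eqVneq (fracv t i ord0) 0.
    by right; rewrite ltxx.
  by left; rewrite lt_def fn0.
move=> [/andP[]//|]; rewrite f1 andbT => /negP; rewrite -leNgt => f0'.
exact: le_lt_trans a0.
Qed.

(** The sets whose preimage is a multiplier set form a sigma-algebra. For a single coordinate it
    contains the rays, hence all Borel sets of the line; these in turn generate the Borel sets of
    column vectors. *)
Let multiplier_fracv (A : set V) : measurable A -> multiplier_set (fracv @^-1` A).
Proof.
have me := cmeasurable_expl.
have SA := sigma_algebra_multiplier_set mu mF me sqn_expl expl0 explD.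
have sub : measurable `<=` image_set_system setT fracv multiplier_set.
  apply: smallest_sub; first exact: sigma_algebra_image.
  rewrite -bigcup_seq/=; apply: bigcup_sub => i _ _ [C mC <-].
  rewrite /image_set_system /= !setTI.
  have SA' := sigma_algebra_image (fun t => fracv t i ord0) SA.
  have subR : (measurable : set (set R)) `<=`
      image_set_system setT (fun t => fracv t i ord0) multiplier_set.
    rewrite [X in X `<=` _](RGenInftyO.measurableE R); apply: smallest_sub => // _ [a ->].
    rewrite /image_set_system /= setTI.
    rewrite (_ : _ @^-1` _ = [set t | fracv t i ord0 < a]).
      exact: multiplier_fracv_lt.
    by apply/seteqP; split => t; rewrite /= in_itv.
  by have := subR _ mC; rewrite /image_set_system /= setTI.
by move=> /sub; rewrite /image_set_system /= setTI.
Qed.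

Let mulmx_fracv t :
  M *m fracv t = t - latv M (\col_i Num.floor ((invmx M *m t) i ord0)).
Proof.
rewrite -[X in X - _](mulKVmx uM) /latv -mulmxBr; congr (_ *m _).
by apply/colP => i; rewrite !mxE.
Qed.

Lemma measurable_shifts (A : set V) : measurable A ->
  measurable (\bigcup_k [set t | A (t - latv M k)]).
Proof.
move=> mA; apply: countable_bigcupT_measurable; first exact: countableP.
by move=> k; rewrite -[X in measurable X]setTI; exact: measurable_fun_shift.
Qed.

Let shifts_periodic (A : set V) t k :
  (\bigcup_k [set t | A (t - latv M k)]) (t - latv M k) <->
  (\bigcup_k [set t | A (t - latv M k)]) t.
Proof.
split=> -[l _ /= At].
  by exists (k + l) => //=; rewrite latvD opprD addrA.
by exists (l - k) => //=; rewrite latvB opprB addrA subrK.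
Qed.

(** The periodization [U] of the part of [A] in [F] is a preimage under [fracv], so its indicator is
    a multiplier. Apply it to the approximable constant 1: on [F], which meets each orbit once, [U]
    and [A] coincide. *)
Let approximable_indic (A : set V) : measurable A ->
  approximable mu F expl (fun t => Complex (\1_A t) 0).
Proof.
move=> mA; pose U := \bigcup_k [set t | (A `&` F) (t - latv M k)].
have mU : measurable U by apply: measurable_shifts; exact: measurableI.
have UE : fracv @^-1` [set x | U (M *m x)] = U.
  apply/seteqP; split => t /=; rewrite mulmx_fracv.
    exact: (shifts_periodic _ _ _).1.
  exact: (shifts_periodic _ _ _).2.
have mA' : measurable [set x | U (M *m x)].
  by rewrite -[X in measurable X]setTI; exact: measurable_fun_mulmx.
have [_ [_ _ mult]] := multiplier_fracv mA'; rewrite UE in mult.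
have sq1 : square_integrable mu F (fun=> 1).
  have := square_integrable_e mF muF cmeasurable_expl sqn_expl 0.
  by congr square_integrable; apply/funext => t; exact: expl0.
have := mult _ sq1 (approximable1 mu F expl0); apply: approximable_ext => t Ft.
rewrite mulr1; congr (Complex _ 0); rewrite !indicE.
rewrite (_ : (t \in U) = (t \in A))//; apply/idP/idP => /set_mem.
  move=> [k _ [/= Ak Fk]]; apply/mem_set.
  have [k0 k0E] := tileF t.
  have k00 : 0 = k0 by apply/k0E; rewrite latv0 subr0.
  by move: Fk Ak => /k0E ->; rewrite -k00 latv0 subr0.
by move=> At; apply/mem_set; exists 0 => //=; rewrite latv0 subr0.
Qed.

Lemma lattice_parseval_tile (h : V -> R[i]) : cmeasurable h ->
  (forall t, ~ F t -> h t = 0) -> (\int[mu]_t (sqn (h t))%:E < +oo)%E ->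
  (\esum_(k in [set: 'cV[int]_d]) (sqn (inner h (expl k)))%:E =
   `|\det M|%:E * \int[mu]_t (sqn (h t))%:E)%E.
Proof.
move=> mh hF h2.
have sqn0 : sqn (0 : R[i]) = 0 by rewrite /sqn /= expr0n addr0.
have FE : (\int[mu]_(t in F) (sqn (h t))%:E = \int[mu]_t (sqn (h t))%:E)%E.
  rewrite integral_mkcond; apply: eq_integral => t _; rewrite patchE.
  by case: ifPn => // /negP tF; rewrite hF ?sqn0// => Ft; apply: tF; exact/mem_set.
have sqh : square_integrable mu F h by split => //; rewrite FE.
have me := cmeasurable_expl.
have ah := approximable_square_integrable mF me sqn_expl expl0 explD approximable_indic sqh.
have := parseval mF detM_gt0 muF me sqn_expl expl_orthogonal sqh ah.
rewrite EFinM /energy /Rintegral fineK; last first.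
  by rewrite FE ge0_fin_numE// integral_ge0// => t _; rewrite lee_fin sqn_ge0.
rewrite FE => <-; apply: eq_esum => k _; congr (sqn _)%:E.
rewrite /inner /coef /cint.
have ZE (f : R[i] -> R) : f 0 = 0 ->
    \int[mu]_t f (h t * conjc (expl k t)) = \int[mu]_(t in F) f (h t * conjc (expl k t)).
  move=> f0; rewrite [RHS]Rintegral_mkcond; apply: eq_Rintegral => t _; rewrite patchE.
  case: ifPn => // /negP tF; rewrite hF ?mul0r// => Ft; apply: tF; exact/mem_set.
by rewrite (ZE (@complex.Re R)) ?(ZE (@complex.Im R)).
Qed.

End lattice_parseval.

Section lattice_parseval_packing.
Context {R : realType} {d : nat}.
Local Notation V := 'cV[R]_d.
Local Notation mu := (lebesgue_cV R d).
Variables M B : 'M[R]_d.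
Hypothesis BM : B^T *m M = 1%:M.

(** The pointwise form of packing, with no exceptional null set. *)
Definition disjoint_translates (P : set V) := forall t k l,
  P (t - latv M k) -> P (t - latv M l) -> k = l.

Lemma lattice_parseval (P : set V) (h : V -> R[i]) : measurable P ->
  disjoint_translates P -> cmeasurable h ->
  (forall t, ~ P t -> h t = 0) -> (\int[mu]_t (sqn (h t))%:E < +oo)%E ->
  (\esum_(k in [set: 'cV[int]_d]) (sqn (inner h (expl B k)))%:E =
   `|\det M|%:E * \int[mu]_t (sqn (h t))%:E)%E.
Proof.
move=> mP packP mh hP h2.
have uM : M \in unitmx by have /mulmx1_unit[] := BM.
pose U := \bigcup_k [set t | P (t - latv M k)].
(* Completing P by the points of the unit cell whose orbits avoid P gives an  *)
(* exact fundamental domain.                                                  *)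
pose F := P `|` (cell M `\` U).
have mF : measurable F.
  apply: measurableU => //; apply: measurableD; first exact: measurable_cell.
  exact: measurable_shifts.
apply: (lattice_parseval_tile BM mF) => //; last first.
  by move=> t Ft; apply: hP => Pt; apply: Ft; left.
move=> t; have [[k0 _ /= Pk0]|nU] := pselect (U t).
  exists k0 => k; split => [|->]; last by left.
  move=> [Pk|[_ []]]; first exact: packP Pk Pk0.
  by exists (k0 - k) => //=; rewrite latvB opprB addrA subrK.
exists (\col_i Num.floor ((invmx M *m t) i ord0)) => k; split.
  move=> [Pk|[/(cellP uM)]]; last by [].
  by exfalso; apply: nU; exists k.
move=> kE; right; split; first exact/(cellP uM).
by move=> [l _ /= Pl]; apply: nU; exists (k + l) => //=; rewrite latvD opprD addrA.
Qed.

End lattice_parseval_packing.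

(** * Smoothed fundamental domains *)

Section borel_cV.
Context {R : realType} {d : nat}.
Local Notation V := 'cV[R]_d.

Lemma measurable_floor_fun (a : R) (g : 'cV[int]_d -> R) :
  measurable_fun setT (fun x : V => g (\col_i Num.floor (a * x i ord0))).
Proof.
move=> _ Y mY; rewrite setTI.
pose cube (k : 'cV[int]_d) := [set x : V | forall i,
  ((fun y => a * y) @^-1` `[(k i ord0)%:~R, (k i ord0 + 1)%:~R[%classic) (x i ord0)].
have cubeE x k : cube k x <-> k = \col_i Num.floor (a * x i ord0).
  split=> [h|-> i]; last by rewrite /= in_itv/= mxE floor_itv.
  apply/colP => i; rewrite mxE; apply/esym/floor_def.
  by have := h i; rewrite /= in_itv.
rewrite (_ : _ @^-1` Y = \bigcup_k (if g k \in Y then cube k else set0)).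
  apply: countable_bigcupT_measurable; first exact: countableP.
  move=> k; case: ifPn => // _; apply: (@measurable_coord_box _ _ (fun i =>
    (fun y => a * y) @^-1` `[(k i ord0)%:~R, (k i ord0 + 1)%:~R[%classic)) => i.
  rewrite -[X in measurable X]setTI.
  by apply: (mulrl_measurable a) => //; exact: measurable_itv.
apply/seteqP; split => x /=.
  move=> Yx; exists (\col_i Num.floor (a * x i ord0)) => //.
  by rewrite mem_set//; exact/cubeE.
by move=> [k _]; case: ifPn => // /set_mem Yk /cubeE <-.
Qed.

(** The sigma-algebra is generated by the coordinates, so [f] is written as the limit of its values
    at coordinates rounded down to multiples of [n.+1%:R^-1]; each approximant is constant on
    countably many cubes. *)
Lemma continuous_measurable_cV (f : V -> R) : continuous f -> measurable_fun setT f.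
Proof.
move=> cf.
pose q n (x : V) : V := \col_i ((Num.floor (n.+1%:R * x i ord0))%:~R / n.+1%:R).
apply: (@measurable_fun_cvg _ _ _ _ (fun n x => f (q n x))).
  move=> n.
  have := measurable_floor_fun n.+1%:R
    (fun k : 'cV[int]_d => f (\col_i ((k i ord0)%:~R / n.+1%:R))).
  congr measurable_fun; apply/funext => x; congr f.
  by apply/colP => i; rewrite !mxE.
move=> x _; apply: (cvg_comp (fun n => q n x) f); last exact: cf.
apply/cvg_ballP => e e0; near=> n; split => // i j.
rewrite ord1 mxE -ball_normE /= ger0_norm; last first.
  by rewrite subr_ge0 ler_pdivrMr// mulrC floor_le.
apply: (@le_lt_trans _ _ n.+1%:R^-1).
  rewrite lerBlDr -[X in X + _]mul1r -mulrDl ler_pdivlMr// mulrC addrC.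
  by have /andP[_ /ltW] := floor_itv (n.+1%:R * x i ord0); rewrite intrD.
near: n; exact: near_infty_natSinv_lt (PosNum e0).
Unshelve. all: by end_near. Qed.

End borel_cV.

Section nonmeasurable_integrals.
Context {R : realType} {d : measure_display} {X : measurableType d}.
Variable mu : {measure set X -> \bar R}.
Local Open Scope ereal_scope.

(* No measurability is assumed, unlike in [ge0_le_integral]: the integral of  *)
(* a nonnegative function is a supremum over simple functions below it.       *)
Lemma ge0_le_integral_sup (f g : X -> \bar R) : (forall x, 0 <= f x) ->
  (forall x, f x <= g x) -> \int[mu]_x f x <= \int[mu]_x g x.
Proof.
move=> f0 fg; have g0 x : 0 <= g x by exact: le_trans (fg x).
rewrite !ge0_integralTE//; apply: ereal_sup_le => _ [h /= hf <-].
by exists h => // x; exact: le_trans (hf x) (fg x).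
Qed.

Lemma negligible_bigcup_countable (T : countType) (N : T -> set X) :
  (forall k, mu.-negligible (N k)) -> mu.-negligible (\bigcup_k N k).
Proof.
move=> negN.
apply: (@negligibleS _ _ _ _ (\bigcup_n oapp N set0 (pickle_inv n))).
  by move=> x [k _ Nk]; exists (pickle k) => //; rewrite pickleK_inv.
by apply: negligible_bigcup => n; case: pickle_inv => [k|] //=; exact: negligible_set0.
Qed.

End nonmeasurable_integrals.

(** * The smoothed indicator as a weight *)

Section window.
Context {R : realType} {d : nat}.
Local Notation V := 'cV[R]_d.
Local Notation mu := (lebesgue_cV R d).
Variables (phi : V -> R) (eps : R).
Hypothesis mphi : measurable_fun setT phi.
Hypothesis phi_ge0 : forall x, 0 <= phi x.
Hypothesis phi_int : (\int[mu]_x (phi x)%:E = 1)%E.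
Hypothesis eps_gt0 : 0 < eps.

Let psi := dilate eps phi.

Let psi_ge0 x : 0 <= psi x.
Proof. by rewrite mulr_ge0// invr_ge0 exprn_ge0// ltW. Qed.

Let mpsi : measurable_fun setT psi.
Proof.
apply: measurable_funM => //.
have mZ : measurable_fun [set: V] (fun x : V => eps^-1 *: x).
  apply: eq_measurable_fun (measurable_fun_mulmx eps^-1%:M) => x _.
  by rewrite mul_scalar_mx.
exact: (measurableT_comp mphi mZ).
Qed.

Let integral_psi t : (\int[mu]_y (psi (t - y))%:E = 1)%E.
Proof.
have e0 : eps^-1 != 0 by rewrite invr_eq0 gt_eqF.
(* The linear part of the substitution sending [y] to [eps^-1 *: (t - y)]; the absolute value of its
   determinant is the normalizing factor in [dilate]. *)
pose S : 'M[R]_d := (- eps^-1)%:M.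
have uS : S \in unitmx by rewrite unitmxE det_scalar unitrX// unitfE oppr_eq0.
have mE : measurable_fun setT (fun x => (phi x)%:E) by exact/measurable_EFinP.
have p0 x : (0 <= (phi x)%:E)%E by rewrite lee_fin.
rewrite -phi_int -(ge0_integral_shift (eps^-1 *: t) mE p0).
have ms : measurable_fun setT (fun x : V => (phi (x + eps^-1 *: t))%:E).
  by apply/measurable_EFinP; exact: measurable_shift_fun.
rewrite -(ge0_integral_mulmx uS ms (fun=> p0 _)) -ge0_integralZl//; last first.
  exact: (measurableT_comp ms (measurable_fun_mulmx S)).
apply: eq_integral => y _; rewrite -EFinM; congr EFin; rewrite /psi /dilate.
congr (_ * phi _); last by rewrite mul_scalar_mx scalerBr scaleNr addrC.
by rewrite det_scalar normrX normrN ger0_norm ?invr_ge0 ?ltW// exprVn.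
Qed.

Variables (M : 'M[R]_d) (Omega : set V).
Hypothesis uM : M \in unitmx.
Hypothesis mOmega : lebesgue_measurable Omega.
Hypothesis tileOmega : fundamental_domain (lattice M) Omega.

Lemma latv_inj (k l : 'cV[int]_d) : latv M k = latv M l -> k = l.
Proof.
move=> /(congr1 (mulmx (invmx M))); rewrite /latv !mulKmx// => /colP kl.
by apply/colP => i; have := kl i; rewrite !mxE => /eqP; rewrite eqr_int => /eqP.
Qed.

Lemma lattice_latv (k : 'cV[int]_d) : lattice M (latv M k).
Proof. by exists k. Qed.

Lemma translateP (A : set V) v t : translate A v t <-> A (t - v).
Proof.
split=> [[x Ax <-]|At]; first by rewrite addrK.
by exists (t - v) => //; rewrite subrK.
Qed.

Lemma negligible_packing_overlap (A : set V) : packing_set (lattice M) A ->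
  mu.-negligible [set t | exists k l, [/\ k <> l, A (t - latv M k) & A (t - latv M l)]].
Proof.
move=> pA.
pose N (kl : 'cV[int]_d * 'cV[int]_d) := if kl.1 == kl.2 then set0
  else translate A (latv M kl.1) `&` translate A (latv M kl.2).
apply: (@negligibleS _ _ _ _ (\bigcup_kl N kl)).
  move=> t [k [l [/eqP kl Ak Al]]]; exists (k, l) => //; rewrite /N /= (negbTE kl).
  by split; exact/translateP.
apply: negligible_bigcup_countable => -[k l]; rewrite /N /=; case: ifPn => [_|kl].
  exact: negligible_set0.
apply: (pA (latv M k) (latv M l)); [exact: lattice_latv|exact: lattice_latv|].
by apply: contra kl => /eqP/latv_inj ->.
Qed.

(** Weights are Borel, whereas [Omega] is only Lebesgue measurable, so a Borel set [B] equal to it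
    up to a null set is used. Only countably many translates of null sets arise, and off their union
    exactly one translate of [B] contains the point. *)
Lemma weight_fundamental_domain : exists2 B : set V,
  mu.-negligible ((Omega `\` B) `|` (B `\` Omega)) & measurable B /\ weight M \1_B.
Proof.
have [B mB negB] := mOmega; exists B => //; split => //.
have [packO coverO] := tileOmega.
split => //.
pose N1 := \bigcup_k [set t | ((Omega `\` B) `|` (B `\` Omega)) (t - latv M k)].
pose N2 := [set t | exists k l, [/\ k <> l, Omega (t - latv M k) & Omega (t - latv M l)]].
have negN : mu.-negligible (N1 `|` N2 `|` ~` \bigcup_(u in lattice M) translate Omega u).
  apply: negligibleU => //; apply: negligibleU; last exact: negligible_packing_overlap.
  by apply: negligible_bigcup_countable => k; exact: negligible_shift.
apply: negligibleS negN => t /= nt; apply: contrapT => tN; apply: nt.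
have OB k : Omega (t - latv M k) <-> B (t - latv M k).
  split=> [Ok|Bk]; apply: contrapT => nk; apply: tN; left; left; exists k => //=.
    by left.
  by right.
have [_ [k0 _ <-] /translateP Ok0] : (\bigcup_(u in lattice M) translate Omega u) t.
  by apply: contrapT => h; apply: tN; right.
apply: (@lsum_indic_unique _ _ _ _ _ k0) => k; rewrite -OB; split=> [Ok|->//].
apply: contrapT => kk0; apply: tN; left; right; exists k, k0; split => //.
Qed.

Let conv := convolution (\1_Omega) psi.

(** Away from the fattening the integrand vanishes identically: a nonzero value would yield a point
    of [Omega] within [eps] of [t]. *)
Lemma convolution_supp t : conv t != 0 -> (forall x, supp phi x -> enorm x <= 1) ->
  fattening Omega eps t.
Proof.
move=> ct sphi; apply: contrapT => nf; move: ct; rewrite /conv /convolution.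
rewrite (_ : (fun y => _) = cst 0) ?Rintegral_cst ?mul0r ?eqxx//.
apply/funext => y /=; rewrite indicE; have [|] := boolP (y \in Omega); last by rewrite mul0r.
move=> /set_mem Oy; rewrite mul1r /psi /dilate.
have [->|p0] := eqVneq (phi (eps^-1 *: (t - y))) 0; first by rewrite mulr0.
exfalso; apply: nf; exists y => //; exists (t - y) => /=; last by rewrite addrC subrK.
have : enorm (eps^-1 *: (t - y)) <= 1 by apply: sphi; apply: subset_closure.
rewrite /enorm (_ : dotv _ _ = eps^-1 ^+ 2 * dotv (t - y) (t - y)); last first.
  by rewrite /dotv mulr_sumr; apply: eq_bigr => i _; rewrite !mxE; ring.
rewrite sqrtrM ?sqr_ge0// sqrtr_sqr gtr0_norm ?invr_gt0//.
by rewrite ler_pdivrMl// mulr1.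
Qed.

(** Exchanging sum and integral, the lattice sum at [t] is the integral of [psi (t - y)] against
    [lsum M \1_B y], which is 1 for almost every [y]. Hence the sum is the integral of
    [psi (t - y)], and equals 1 at every [t]. *)
Lemma weight_convolution : weight M conv.
Proof.
have [B negB [mB wB]] := weight_fundamental_domain.
have [mIB IB0 lB] := wB.
pose f (p : V * V) : \bar R := (\1_B p.2 * psi (p.1 - p.2))%:E.
have mf : measurable_fun setT f.
  apply/measurable_EFinP; apply: measurable_funM.
    exact: (measurableT_comp mIB measurable_snd).
  apply: (measurableT_comp mpsi); apply/measurable_fun_cVP => i.
  under eq_fun do rewrite !mxE.
  apply: measurable_funB.
    exact: (measurableT_comp (measurable_cV_coord i) measurable_fst).
  exact: (measurableT_comp (measurable_cV_coord i) measurable_snd).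
have f0 p : (0 <= f p)%E by rewrite lee_fin mulr_ge0.
pose G t : \bar R := (\int[mu]_y f (t, y))%E.
have mG : measurable_fun setT G by exact: (measurable_fun_fubini_tonelli_F f).
have G0 t : (0 <= G t)%E by exact: integral_ge0.
have mpsiy (t : V) : measurable_fun setT (fun y : V => psi (t - y)).
  apply: (measurableT_comp mpsi).
  apply: eq_measurable_fun (measurable_fun_mulmxD (- 1%:M) t) => y _.
  by rewrite mulNmx mul1mx addrC.
have mfy (t : V) : measurable_fun setT (fun y => f (t, y)).
  apply/measurable_EFinP; apply: measurable_funM => //.
  exact: mpsiy.
have Gfin t : G t \is a fin_num.
  rewrite ge0_fin_numE//; apply: le_lt_trans (ltry 1); rewrite -(integral_psi t).
  apply: ge0_le_integral_sup => y; first exact: f0.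
  by rewrite lee_fin ler_piMl// indicE lern1 leq_b1.
have convE t : conv t = fine (G t).
  rewrite /conv /convolution /Rintegral; congr fine.
  have [N [mN N0 BN]] := negB.
  (* The integrand with [Omega] itself need not be Borel. Its integral is squeezed between those for
     the Borel sets [B] minus [N] and [B] united with [N], which are equal since [N] is null. *)
  have outN (A : set V) : (forall y, ~ N y -> A y <-> B y) ->
      (\int[mu]_y (\1_A y * psi (t - y))%:E = G t)%E.
    move=> AB; apply/eqP; rewrite eq_le.
    have ae_eq (C : set V) : measurable C -> (forall y, ~ N y -> C y <-> B y) ->
        (\int[mu]_y (\1_C y * psi (t - y))%:E = G t)%E.
      move=> mC CB; apply: ge0_ae_eq_integral => //.
      - apply/measurable_EFinP; apply: measurable_funM; first exact: measurable_indic.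
        exact: mpsiy.
      - by move=> y _; rewrite lee_fin mulr_ge0.
      - exists N; split => // y /= yN; apply: contrapT => nN; apply: yN => _.
        rewrite /f /= !indicE (_ : (y \in C) = (y \in B))//.
        by apply/idP/idP => /set_mem /(CB _ nN) ?; exact/mem_set.
    have le_ind (C D : set V) (y : V) : C `<=` D ->
        ((\1_C y * psi (t - y))%:E <= (\1_D y * psi (t - y))%:E :> \bar R)%E.
      move=> CD; rewrite lee_fin ler_wpM2r// !indicE ler_nat.
      case: (boolP (y \in C)) => // /set_mem/CD/mem_set ->//.
    apply/andP; split.
      rewrite -(ae_eq (B `|` N)); last 2 first.
      - exact: measurableU.
      - by move=> y Ny; split=> [[]//|]; left.
      apply: ge0_le_integral_sup => y; first by rewrite lee_fin mulr_ge0.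
      apply: le_ind => z Az; have [|nz] := pselect (N z); [by right|left].
      exact/(AB _ nz).
    rewrite -(ae_eq (B `\` N)); last 2 first.
    - exact: measurableD.
    - by move=> y Ny; split=> [[]//|]; split.
    apply: ge0_le_integral_sup => y; first by rewrite lee_fin mulr_ge0.
    by apply: le_ind => z [Bz nz]; exact/(AB _ nz).
  apply: outN => y Ny; split=> [Oy|By]; apply: contrapT => nn; apply: Ny; apply: BN.
    by left.
  by right.
split.
- rewrite (_ : conv = fine \o G); last by apply/funext => t; rewrite convE.
  by apply: measurableT_comp => //; exact: fine_measurable.
- by move=> t; rewrite convE fine_ge0.
apply: aeW => t; rewrite /lsum.
transitivity (\esum_(k in [set: 'cV[int]_d])
    \int[mu]_y (\1_B (y - latv M k) * psi (t - y))%:E)%E.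
  apply: eq_esum => k _; rewrite convE fineK// /G.
  rewrite -(ge0_integral_shift (- latv M k) (mfy _))//.
  by apply: eq_integral => y _; rewrite /f /= opprB addrA subrK.
rewrite -ge0_integral_esum; last 2 first.
- move=> k; apply/measurable_EFinP; apply: measurable_funM.
    exact: measurable_shift_fun.
  exact: mpsiy.
- by move=> k y; rewrite lee_fin mulr_ge0.
rewrite -(integral_psi t); apply: ge0_ae_eq_integral => //.
- apply: measurable_fun_esum => [k|k y]; last by rewrite lee_fin mulr_ge0.
  apply/measurable_EFinP; apply: measurable_funM; first exact: measurable_shift_fun.
  exact: mpsiy.
- by apply/measurable_EFinP; exact: mpsiy.
- by move=> y _; apply: esum_ge0 => k _; rewrite lee_fin mulr_ge0.
- by move=> y _; rewrite lee_fin.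
- apply: filterS lB => y lBy _; rewrite -[RHS]mule1 -lBy /lsum -ge0_esumZl//.
  by apply: eq_esum => k _; rewrite mulrC EFinM.
Qed.

End window.

(** * Gabor systems *)

Section L2_functions.
Context {R : realType} {d : nat}.
Local Notation V := 'cV[R]_d.
Local Notation mu := (lebesgue_cV R d).
Implicit Types (f g h : V -> R[i]) (w : V -> R).

Lemma poweR2 (x : \bar R) : (0 <= x)%E -> (x `^ 2 = x ^+ 2)%E.
Proof.
case: x => [r| |]//; last by rewrite poweRyr// expe2 mulyy.
by rewrite lee_fin => r0; rewrite poweR_EFin powR_mulrn// EFin_expe.
Qed.

Lemma L2norm_sqr f : (L2norm f ^+ 2 = \int[mu]_t (sqn (f t))%:E)%E.
Proof.
rewrite -poweR2 ?Lnorm_ge0// /L2norm powR_Lnorm//; apply: eq_integral => t _.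
have n0 : (0 <= (ComplexField.Normc.normc (f t))%:E)%E.
  by rewrite lee_fin; case: (f t) => a b; exact: sqrtr_ge0.
by rewrite gee0_abs// poweR2// -EFin_expe normc_sqr.
Qed.

Lemma L2P f : L2 f <-> cmeasurable f /\ (\int[mu]_t (sqn (f t))%:E < +oo)%E.
Proof.
have E : (\int[mu]_t (sqn (f t))%:E = L2norm f `^ 2)%E.
  by rewrite poweR2 ?L2norm_sqr// Lnorm_ge0.
split=> [[m1 m2 f2]|[[m1 m2] f2]]; split => //; first by rewrite E poweR_lty.
by apply: (@lty_poweRy _ _ 2) => //; rewrite -E.
Qed.

Lemma inner_ae f f' h h' : cmeasurable f -> cmeasurable f' ->
  cmeasurable h -> cmeasurable h' ->
  {ae mu, forall t, f t = f' t} -> {ae mu, forall t, h t = h' t} ->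
  inner f h = inner f' h'.
Proof.
move=> mf mf' mh mh' ff' hh'.
have [m1 m2] := cmeasurableM mf (cmeasurable_conjc mh).
have [m1' m2'] := cmeasurableM mf' (cmeasurable_conjc mh').
have ae : {ae mu, forall t, f t * conjc (h t) = f' t * conjc (h' t)}.
  by apply: filterS2 ff' hh' => t -> ->.
rewrite /inner /Rintegral; congr (Complex (fine _) (fine _)); apply: ae_eq_integral => //.
- exact/measurable_EFinP.
- exact/measurable_EFinP.
- by apply: filterS ae => t -> _.
- exact/measurable_EFinP.
- exact/measurable_EFinP.
- by apply: filterS ae => t -> _.
Qed.

Definition root_window w t : R[i] := Complex (Num.sqrt (w t)) 0.

Lemma cmeasurable_root_window w : measurable_fun setT w -> cmeasurable (root_window w).
Proof.
move=> mw; apply: cmeasurable_real.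
have ms : measurable_fun setT (@Num.sqrt R).
  by apply: continuous_measurable_fun; exact: sqrt_continuous.
exact: (measurableT_comp ms mw).
Qed.

Lemma cmeasurable_shift g v : cmeasurable g -> cmeasurable (fun t : V => g (t + v)).
Proof.
by move=> [m1 m2]; split;
  [exact: (measurable_shift_fun v m1)|exact: (measurable_shift_fun v m2)].
Qed.

Lemma cmeasurable_tfshift g (l : V * V) : cmeasurable g -> cmeasurable (tfshift g l).
Proof.
move=> mg; apply: cmeasurableM; last exact: cmeasurable_shift.
by split; [exact: measurable_cos_dotv|exact: measurable_sin_dotv].
Qed.

Lemma sqn_tfshift_root w (l : V * V) t : (forall t, 0 <= w t) ->
  sqn (tfshift (root_window w) l t) = w (t - l.1).
Proof. by move=> w0; rewrite sqnM sqn_expi mul1r sqn_real sqr_sqrtr. Qed.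

(** The squared modulus is a translate of [w], whose integral is the covolume of the lattice. *)
Lemma L2_tfshift_root (M : 'M[R]_d) w (l : V * V) : M \in unitmx -> weight M w ->
  L2 (tfshift (root_window w) l).
Proof.
move=> uM ww; have [mw w0 _] := ww; apply/L2P; split.
  by apply: cmeasurable_tfshift; exact: cmeasurable_root_window.
under eq_integral do rewrite sqn_tfshift_root//.
by rewrite (integral_weight uM (weight_shift (- l.1) ww)) ltry.
Qed.

Lemma weight_ae (M : 'M[R]_d) w w' : weight M w -> measurable_fun setT w' ->
  (forall t, 0 <= w' t) -> {ae mu, forall t, w t = w' t} -> weight M w'.
Proof.
move=> [mw w0 w1] mw' w'0 ww'; split => //.
have aek : {ae mu, forall t, forall k, w (t - latv M k) = w' (t - latv M k)}.
  apply: (@negligibleS _ _ _ _ (\bigcup_k [set t | w (t - latv M k) <> w' (t - latv M k)])).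
    by move=> t /= /existsNP[k nk]; exists k.
  by apply: negligible_bigcup_countable => k; exact: (ae_shift (- latv M k) ww').
by apply: filterS2 w1 aek => t <- wk; apply: eq_esum => k _; rewrite wk.
Qed.

Lemma packing_core (M : 'M[R]_d) (S : set V) : M \in unitmx -> measurable S ->
  packing_set (lattice M) S -> exists P, [/\ measurable P, P `<=` S,
    mu.-negligible (S `\` P) & disjoint_translates M P].
Proof.
move=> uM mS /(negligible_packing_overlap uM)[N [mN N0 SN]].
exists (S `\` N); split; first exact: measurableD.
- by move=> t [].
- exists N; split => // t [St]; apply: contra_notP => nt; split => //.
move=> t k l [Sk Nk] [Sl _]; apply: contrapT => kl; apply: Nk; apply: SN.
(* Seen from the point [t - latv M k], the two overlapping translates have indices 0 and [l - k]. *)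
exists 0, (l - k); split.
- by move=> /esym/eqP; rewrite subr_eq0 => /eqP lk; exact: kl.
- by rewrite latv0 subr0.
- by rewrite latvB opprB addrA subrK.
Qed.

End L2_functions.

Section gabor_system.
Context {R : realType} {d : nat}.
Local Notation V := 'cV[R]_d.
Local Notation mu := (lebesgue_cV R d).
Variables (A B M : 'M[R]_d).
Hypotheses (uA : A \in unitmx) (BM : B^T *m M = 1%:M).

Let uB : B \in unitmx.
Proof. by have /mulmx1_unit[] := BM; rewrite unitmx_tr. Qed.

Let uM : M \in unitmx.
Proof. by have /mulmx1_unit[] := BM. Qed.

Lemma esum_lattice_setX (a : V * V -> \bar R) : (forall l, 0 <= a l)%E ->
  (\esum_(l in lattice A `*` lattice B) a l =
   \esum_(j in [set: 'cV[int]_d]) \esum_(k in [set: 'cV[int]_d]) a (latv A j, latv B k))%E.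
Proof.
move=> a0; rewrite (esum_esum (a := fun j k => a (latv A j, latv B k)))//.
rewrite (reindex_esum ([set: 'cV[int]_d] `*`` (fun=> [set: 'cV[int]_d]))
  _ (fun jk => (latv A jk.1, latv B jk.2)))//.
split.
- by move=> [j k] _; split; exact: lattice_latv.
- move=> [j k] [j' k'] _ _ /= [/(latv_inj uA) jj' /(latv_inj uB) kk'].
  by rewrite jj' kk'.
by move=> [x y] [/= [j _ <-] [k _ <-]]; exists (j, k).
Qed.

Variables (w : V -> R) (P : set V).
Hypotheses (mP : measurable P) (wP : forall t, ~ P t -> w t = 0).

(** For a fixed translation [j], the product [h j] is carried by a translate of [P], so Parseval
    sums over the frequencies. Summing the energies of the [h j] over [j] then rebuilds
    [lsum A w = 1]; this sum also shows that each energy is finite. *)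
Lemma tight_frame_identity (f : V -> R[i]) : weight A w -> disjoint_translates M P ->
  cmeasurable f -> (\int[mu]_t (sqn (f t))%:E < +oo)%E ->
  (\esum_(l in lattice A `*` lattice B)
     (sqn (inner f (tfshift (root_window w) l)))%:E =
   `|\det M|%:E * \int[mu]_t (sqn (f t))%:E)%E.
Proof.
move=> [mw w0 w1] dP mf f2.
rewrite esum_lattice_setX; last by move=> l; rewrite lee_fin sqn_ge0.
pose h j t := f t * root_window w (t - latv A j).
have mh j : cmeasurable (h j).
  apply: cmeasurableM => //; apply: (@cmeasurable_shift _ _ (root_window w)).
  exact: cmeasurable_root_window.
have sqh j t : (sqn (h j t))%:E = ((sqn (f t))%:E * (w (t - latv A j))%:E)%E.
  by rewrite -EFinM sqnM sqn_real sqr_sqrtr.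
have sumh : (\esum_(j in [set: 'cV[int]_d]) \int[mu]_t (sqn (h j t))%:E =
    \int[mu]_t (sqn (f t))%:E)%E.
  have msq j : measurable_fun setT (fun t => (sqn (h j t))%:E) by exact: measurable_sqnE.
  rewrite -ge0_integral_esum//; last by move=> j t; rewrite lee_fin sqn_ge0.
  apply: ge0_ae_eq_integral => //.
  - by apply: measurable_fun_esum => // j t; rewrite lee_fin sqn_ge0.
  - exact: measurable_sqnE.
  - by move=> t _; apply: esum_ge0 => j _; rewrite lee_fin sqn_ge0.
  - by move=> t _; rewrite lee_fin sqn_ge0.
  - apply: filterS w1 => t w1t _; rewrite -[RHS]mule1 -w1t /lsum -ge0_esumZl ?sqn_ge0//.
    + by apply: eq_esum => j _; rewrite sqh.
    + by move=> j; rewrite lee_fin.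
have h2 j : (\int[mu]_t (sqn (h j t))%:E < +oo)%E.
  apply: le_lt_trans f2; rewrite -sumh; apply: esum_ge; exists [set j].
    by split.
  by rewrite fsbig_set1.
rewrite -sumh -ge0_esumZl//; last first.
  by move=> j; apply: integral_ge0 => t _; rewrite lee_fin sqn_ge0.
apply: eq_esum => j _.
have mPj : measurable [set t | P (t - latv A j)].
  by rewrite -[X in measurable X]setTI; exact: measurable_fun_shift.
have dPj : disjoint_translates M [set t | P (t - latv A j)].
  by move=> t k l /= Pk Pl; apply: (dP (t - latv A j)); rewrite addrAC.
have hP t : ~ P (t - latv A j) -> h j t = 0.
  by move=> /wP w00; rewrite /h /root_window w00 sqrtr0 mulr0.
rewrite -(lattice_parseval BM mPj dPj (mh j) hP (h2 j)).
apply: eq_esum => k _; congr (sqn _)%:E.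
have E t : f t * conjc (tfshift (root_window w) (latv A j, latv B k) t) =
    h j t * conjc (expl B k t).
  by rewrite /tfshift /h /expl /root_window conjcM conjc_Complex0 [conjc _ * _]mulrC mulrA.
by rewrite /inner; congr Complex; apply: eq_Rintegral => t _; rewrite E.
Qed.

Lemma orthogonality_identity (l l' : V * V) : weight M w -> disjoint_translates A P ->
  (lattice A `*` lattice B) l -> (lattice A `*` lattice B) l' -> l != l' ->
  inner (tfshift (root_window w) l) (tfshift (root_window w) l') = 0.
Proof.
move=> ww dP; have [mw w0 _] := ww.
case: l => x y [/= [j _ <-] [k _ <-]]; case: l' => x' y' [/= [j' _ <-] [k' _ <-]].
rewrite -/(latv A j) -/(latv B k) -/(latv A j') -/(latv B k') => ll'; rewrite /inner.
(* Distinct translations: disjointness of the translates of [P] makes the integrand vanish at every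
   point. *)
have [jj'|jj'] := eqVneq j j'; last first.
  have E t : tfshift (root_window w) (latv A j, latv B k) t *
      conjc (tfshift (root_window w) (latv A j', latv B k') t) = 0.
    rewrite /tfshift; have [Pj|nPj] := pselect (P (t - latv A j)); last first.
      by rewrite /root_window (wP nPj) sqrtr0 mulr0 mul0r.
    have nPj' : ~ P (t - latv A j') by move=> /(dP _ _ _ Pj) /eqP; exact/negP.
    by rewrite conjcM /root_window (wP nPj') sqrtr0 conjc_Complex0 !mulr0.
  by under eq_Rintegral do rewrite E; under [X in Complex _ X]eq_Rintegral do rewrite E;
    rewrite !Rintegral_cst ?mul0r.
(* Equal translations: the two square roots multiply to a translate of [w], integrated against the
   character of the nonzero dual vector [latv B (k - k')]. *)
have kk' : k != k' by apply: contraNneq ll' => ->; rewrite jj'.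
have E t : tfshift (root_window w) (latv A j, latv B k) t *
    conjc (tfshift (root_window w) (latv A j', latv B k') t) =
    expi (2 * pi * dotv (latv B (k - k')) t) * Complex (w (t - latv A j)) 0.
  rewrite -jj' /tfshift conjcM conjc_Complex0 mulrACA -expiN -expiD complex_realM.
  by rewrite -expr2 sqr_sqrtr// latvB dotvDl dotvNl mulrBr.
have v0 : latv B (k - k') != 0 by rewrite (latv_eq0 BM) subr_eq0.
have ws := weight_shift (- latv A j) ww.
have dv := dual_latv BM (k - k').
transitivity (Complex (0 : R) 0) => //; congr Complex.
  rewrite -[RHS](Rintegral_cos_weight uM v0 dv ws); apply: eq_Rintegral => t _.
  by rewrite E ReM /= mulr0 subr0.
rewrite -[RHS](Rintegral_sin_weight uM v0 dv ws); apply: eq_Rintegral => t _.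
by rewrite E ImM /= mulr0 add0r.
Qed.

End gabor_system.

Section exact_window.
Context {R : realType} {d : nat}.
Local Notation V := 'cV[R]_d.
Local Notation mu := (lebesgue_cV R d).

Lemma ae_tfshift (g g' : V -> R[i]) (l : V * V) : {ae mu, forall t, g t = g' t} ->
  {ae mu, forall t, tfshift g l t = tfshift g' l t}.
Proof. by move=> /(ae_shift (- l.1)); apply: filterS => t gg'; rewrite /tfshift gg'. Qed.

(* The packing hypothesis only holds up to null sets; cutting the window off  *)
(* on a null set makes the translates of its support genuinely disjoint.      *)
Lemma window_exact_support (phi : V -> R) (eps : R) (M N : 'M[R]_d) (Omega : set V) :
  measurable_fun setT phi -> (forall x, 0 <= phi x) ->
  supp phi `<=` [set x | enorm x <= 1] -> (\int[mu]_x (phi x)%:E = 1)%E ->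
  0 < eps -> M \in unitmx -> N \in unitmx -> lebesgue_measurable Omega ->
  fundamental_domain (lattice M) Omega ->
  packing_set (lattice N) (fattening Omega eps) ->
  weight M (convolution (\1_Omega) (dilate eps phi)) /\
  exists w P, [/\ forall K, weight K (convolution (\1_Omega) (dilate eps phi)) -> weight K w,
    measurable P, forall t, ~ P t -> w t = 0, disjoint_translates N P &
    {ae mu, forall t, window Omega phi eps t = root_window w t}].
Proof.
move=> mphi phi0 sphi phi1 eps0 uM uN mO tO pO.
set c := convolution _ _.
have wc : weight M c by exact: weight_convolution.
split => //; have [mc c0 _] := wc.
pose S := [set t | c t != 0].
have mS : measurable S.
  rewrite (_ : S = ~` (c @^-1` [set 0])); last first.
    by apply/seteqP; split=> t /=; [move=> /eqP|move=> h; exact/eqP].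
  by apply: measurableC; rewrite -[X in measurable X]setTI; exact: mc.
have SO : S `<=` fattening Omega eps.
  by move=> t ct; apply: (convolution_supp eps0 ct) => x; exact: sphi.
have pS : packing_set (lattice N) S.
  move=> u v Nu Nv uv; apply: negligibleS (pO _ _ Nu Nv uv) => t [].
  by move=> [x Sx xE] [y Sy yE]; split; [exists x|exists y] => //; exact: SO.
have [P [mP PS SP dP]] := packing_core uN mS pS.
pose w t := c t * \1_P t.
have cw : {ae mu, forall t, c t = w t}.
  apply: negligibleS SP => t /= cwt; split.
    by apply/eqP => ct; apply: cwt; rewrite /w ct mul0r.
  by move=> Pt; apply: cwt; rewrite /w indicE mem_set// mulr1.
have mw : measurable_fun setT w by apply: measurable_funM => //; exact: measurable_indic.
have w0 t : 0 <= w t by rewrite mulr_ge0.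
exists w, P; split => //.
- by move=> K wK; exact: (weight_ae wK mw w0 cw).
- by move=> t nPt; rewrite /w indicE memNset// mulr0.
- by apply: filterS cw => t cwt; rewrite /window /root_window -/c cwt.
Qed.

End exact_window.

Theorem theorem4p2 (R : realType) (d : nat) (A B : 'M[R]_d)
    (phi : 'cV[R]_d -> R)
    (hA : A \in unitmx) (hB : B \in unitmx)
    (phi_smooth : Cc_infty phi)
    (phi_ge0 : forall x, 0 <= phi x)
    (phi_supp : supp phi `<=` [set x | enorm x <= 1])
    (phi_int : (\int[lebesgue_cV R d]_x (phi x)%:E = 1)%E) :
  (forall (Omega : set 'cV[R]_d) (eps : R),
     lebesgue_measurable Omega -> 0 < eps ->
     fundamental_domain (lattice A) Omega ->
     packing_set (lattice (invmx B^T)) (fattening Omega eps) ->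
     is_tight_frame (lattice A `*` lattice B)
       (tfshift (window Omega phi eps)) `|\det B|^-1)
  /\
  (forall (Omega : set 'cV[R]_d) (eps : R),
     lebesgue_measurable Omega -> 0 < eps ->
     fundamental_domain (lattice (invmx B^T)) Omega ->
     packing_set (lattice A) (fattening Omega eps) ->
     is_orthogonal_system (lattice A `*` lattice B)
       (tfshift (window Omega phi eps))).
Proof.
have mphi : measurable_fun setT phi.
  by apply: continuous_measurable_cV; have [sm _] := phi_smooth; have [] := sm [::].
have uBT : invmx B^T \in unitmx by rewrite unitmx_inv unitmx_tr.
have BM : B^T *m invmx B^T = 1%:M by rewrite mulmxV// unitmx_tr.
have exact_support (M N : 'M[R]_d) Omega (eps : R) uM uN eps0 mO tO pO :=
  @window_exact_support R d phi eps M N Omega mphi phi_ge0 phi_supp phi_int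
    eps0 uM uN mO tO pO.
have mtf (w : 'cV[R]_d -> R) l :
    measurable_fun setT w -> cmeasurable (tfshift (root_window w) l).
  by move=> mw; apply: cmeasurable_tfshift; exact: cmeasurable_root_window.
split=> Omega eps mO eps0 tO pO.
  have [wc [w [P [ww mP wP dP gE]]]] := exact_support _ _ _ _ hA uBT eps0 mO tO pO.
  have wA := ww _ wc; have [mc c0 _] := wc; have [mw w0 _] := wA.
  split => //; first by rewrite invr_gt0 normr_gt0 -unitfE -unitmxE.
    by move=> l _; exact: (L2_tfshift_root _ hA wc).
  move=> f /L2P[mf f2].
  (* Equality gives both frame inequalities at once. *)
  suff -> : (\esum_(l in lattice A `*` lattice B)
      (ComplexField.Normc.normc (inner f (tfshift (window Omega phi eps) l)) ^+ 2)%:E =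
      `|\det B|^-1%:E * L2norm f ^+ 2)%E by rewrite lexx.
  (* The frame bound is the covolume of the lattice dual to the frequency lattice. *)
  rewrite L2norm_sqr (_ : `|\det B|^-1 = `|\det (invmx B^T)|); last first.
    by rewrite det_inv det_tr normfV.
  rewrite -(tight_frame_identity hA BM mP wP wA dP mf f2); apply: eq_esum => l _.
  rewrite normc_sqr; congr (sqn _)%:E; apply: inner_ae => //.
  - exact: mtf.
  - exact: mtf.
  - exact: aeW.
  - exact: ae_tfshift.
(* The same window construction with the lattices exchanged: tiling now holds for the dual lattice
   and packing for the translations. *)
have [wc [w [P [ww mP wP dP gE]]]] := exact_support _ _ _ _ uBT hA eps0 mO tO pO.
have wM := ww _ wc; have [mc c0 _] := wc; have [mw w0 _] := wM.
split; first by move=> l _; exact: (L2_tfshift_root _ uBT wc).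
move=> l l' Jl Jl' ll'.
rewrite -(orthogonality_identity BM wP wM dP Jl Jl' ll').
by apply: inner_ae; [exact: mtf|exact: mtf|exact: mtf|exact: mtf|
  exact: ae_tfshift|exact: ae_tfshift].
Qed.
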